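(* For $n\geqslant 3$ let $K_n:=K_{\mathbf 1_n}$ be the Loday realization of weight $\mathbf 1_n=(1,\dots,1)$, and orient all Loday realizations as specified in the context. The Loday associahedra determine the sign conventions (B) for $A_\infty$-algebras, namely: as oriented polytopes, $$\partial K_n \;=\; -\bigcup_{\substack{i_1+i_2+i_3=n\\ 2\leqslant i_2\leqslant n-1}} (-1)^{i_1+i_2i_3}\, K_{i_1+1+i_3}\times K_{i_2},$$ where the facet indexed by $(i_1,i_2,i_3)$ is the intersection of $K_n$ with the hyperplane bounding $D_{i_1,i_2,i_3}$, identified through the map $\theta$ with the product $K_{\overline\omega}\times K_{\widetilde\omega}$ of Loday realizations of the associahedra $K_{i_1+1+i_3}$ and $K_{i_2}$, and the sign compares the product orientation with the boundary orientation. Thus the sign of the facet $K_{i_1+1+i_3}\times K_{i_2}$ is the coefficient of $m_{i_1+1+i_3}(\mathrm{id}^{\otimes i_1}\otimes m_{i_2}\otimes \mathrm{id}^{\otimes i_3})$ in the equation (B) $$[m_1,m_n]=-\sum_{\substack{i_1+i_2+i_3=n\\ 2\leqslant i_2\leqslant n-1}}(-1)^{i_1+i_2i_3}\,m_{i_1+1+i_3}(\mathrm{id}^{\otimes i_1}\otimes m_{i_2}\otimes \mathrm{id}^{\otimes i_3}).$$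
   Context: A weight is a list $\omega=(\omega_1,\dots,\omega_n)$ of $n$ positive integers. The Loday realization $K_\omega\subset\mathbb R^{n-1}$ is the intersection of the hyperplane $H_\omega:\ \sum_{i=1}^{n-1}x_i=\sum_{1\leqslant k<l\leqslant n}\omega_k\omega_l$ with the half-spaces $$D_{i_1,i_2,i_3}:\ x_{i_1+1}+\cdots+x_{i_1+i_2-1}\ \geqslant \sum_{i_1+1\leqslant k<l\leqslant i_1+i_2}\omega_k\omega_l,$$ for all $i_1+i_2+i_3=n$ with $i_1,i_3\geqslant 0$ and $2\leqslant i_2\leqslant n-1$. It is a polytope of dimension $n-2$ (a realization of the associahedron $K_n$). Orientation of $K_\omega$: the directing hyperplane of $H_\omega$ has the positively oriented basis $e_j=(1,0,\dots,0,-1,0,\dots,0)$, $1\leqslant j\leqslant n-2$, with $-1$ in position $j+1$ (a point is oriented positively when $n=2$). Facet identification: given $\omega$ and $(i_1,i_2,i_3)$ put $\overline\omega=(\omega_1,\dots,\omega_{i_1},\omega_{i_1+1}+\cdots+\omega_{i_1+i_2},\omega_{i_1+i_2+1},\dots,\omega_n)$, $\widetilde\omega=(\omega_{i_1+1},\dots,\omega_{i_1+i_2})$, and $\theta:\mathbb R^{i_1+i_3}\times\mathbb R^{i_2-1}\to\mathbb R^{n-1}$, $\theta\big((x_1,\dots,x_{i_1+i_3}),(y_1,\dots,y_{i_2-1})\big)=(x_1,\dots,x_{i_1},y_1,\dots,y_{i_2-1},x_{i_1+1},\dots,x_{i_1+i_3})$. Boundary orientation: a basis of the tangent space to the boundary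 is positive iff preceding it by an outward-pointing vector gives a positive basis of the ambient oriented space. *)

(* Defs.v *)
From HB Require Import structures.
From mathcomp Require Import all_boot all_order all_algebra.
From mathcomp Require Import all_classical all_reals all_analysis.
From mathcomp Require Import freeg.

Set Implicit Arguments.
Unset Strict Implicit.
Unset Printing Implicit Defensive.

Import Order.TTheory GRing.Theory Num.Theory numFieldNormedType.Exports.

Local Open Scope classical_set_scope.
Local Open Scope ring_scope.

(* Coordinates and weights are indexed from 0: x_i is [x 0 (i - 1)] and
   omega_k is [tnth w (k - 1)].  Hence a range i1 + 1 <= k <= i1 + i2 for
   indices starting at 1 becomes [i1 <= k < i1 + i2]. *)

Section Loday.
Variable R : realType.

Definition pair_sum n (w : n.-tuple nat) (a b : nat) : nat :=
  (\sum_(k < n) \sum_(l < n | [&& a <= k, k < l & l < b])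
     tnth w k * tnth w l)%N.

Definition block_sum m (i1 i2 : nat) (x : 'rV[R]_m) : R :=
  \sum_(j < m | (i1 <= j < (i1 + i2).-1)%N) x 0 j.

Definition admissible (n i1 i2 i3 : nat) : bool :=
  [&& i1 + i2 + i3 == n, 2 <= i2 & i2 <= n.-1]%N.

(* A weight has positive entries; the definition makes sense for all natural
   entries, and is only applied to the weight (1, ..., 1) and to the weights
   [wbar] and [wtilde] derived from it. *)
Definition loday n (w : n.-tuple nat) : set 'rV[R]_n.-1 :=
  [set x : 'rV[R]_n.-1 | \sum_j x 0 j = (pair_sum w 0 n)%:R /\
    forall i1 i2 i3, admissible n i1 i2 i3 ->
      (pair_sum w i1 (i1 + i2))%:R <= block_sum i1 i2 x].

Definition loday_facet n (w : n.-tuple nat) (i1 i2 : nat) : set 'rV[R]_n.-1 :=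
  loday w `&` [set x : 'rV[R]_n.-1 | block_sum i1 i2 x = (pair_sum w i1 (i1 + i2))%:R].

Definition weight1 n : n.-tuple nat := [tuple of nseq n 1%N].

(* The length i1 + 1 + i3 is written [i1.+1 + i3], so that its predecessor is
   i1 + i3 by conversion. *)
Definition wbar n (w : n.-tuple nat) (i1 i2 i3 : nat) :
    (i1.+1 + i3).-tuple nat :=
  [tuple (if j < i1 then nth 0 w j
          else if j == i1 :> nat then \sum_(i1 <= k < i1 + i2) nth 0 w k
          else nth 0 w (j + i2.-1))%N | j < i1.+1 + i3].

Definition wtilde n (w : n.-tuple nat) (i1 i2 : nat) : i2.-tuple nat :=
  [tuple nth 0%N w (i1 + j) | j < i2].

(* [conform_mx] only transports along i1 + (i2 - 1 + i3) = n - 1, which holds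
   when i1 + i2 + i3 = n and i2 > 0; its default value 0 is then not used. *)
Definition theta n i1 i2 i3 (x : 'rV[R]_(i1 + i3)) (y : 'rV[R]_i2.-1) :
    'rV[R]_n.-1 :=
  conform_mx 0 (row_mx (lsubmx x) (row_mx y (rsubmx x))).
Arguments theta : clear implicits.

Definition theta_prod n i1 i2 i3
    (K : set 'rV[R]_(i1 + i3)) (L : set 'rV[R]_i2.-1) : set 'rV[R]_n.-1 :=
  [set theta n i1 i2 i3 z.1 z.2 | z in K `*` L].

Definition loday_basis n : seq 'rV[R]_n.-1 :=
  [seq \row_(k < n.-1) ((k == 0 :> nat)%:R - (k == j.+1 :> nat)%:R)
     | j <- iota 0 n.-2].

Definition theta_basis n i1 i2 i3
    (E : seq 'rV[R]_(i1 + i3)) (F : seq 'rV[R]_i2.-1) : seq 'rV[R]_n.-1 :=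
  [seq theta n i1 i2 i3 u 0 | u <- E] ++ [seq theta n i1 i2 i3 0 v | v <- F].

End Loday.

Arguments loday R {n} w.
Arguments loday_facet R {n} w i1 i2.
Arguments theta {R} n i1 i2 i3 x y.
Arguments theta_prod {R} n i1 i2 i3 K L.
Arguments theta_basis {R} n i1 i2 i3 E F.

(* An orientation is given by a reference basis E; [oriented s E b] says that
   b is a basis of the span of E and that its sign with respect to E is that of s. *)
Definition oriented (R : realType) (V : lmodType R) (s : int) (E b : seq V) :=
  size b = size E /\
  exists2 P : 'M[R]_(size E),
    forall i : 'I_(size E), b`_i = \sum_j P i j *: E`_j
  & 0 < s%:~R * \det P.

Section Polytopes.
Variables (R : realType) (m : nat).
Implicit Types (S K F : set 'rV[R]_m) (u v : 'rV[R]_m).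

(* The linear span of the differences of points of S. *)
Definition direction S : set 'rV[R]_m :=
  [set u | exists2 X : seq 'rV[R]_m,
     forall d, d \in X -> exists x y, [/\ S x, S y & d = x - y]
   & u \in <<X>>%VS].

Definition affine_hull S : set 'rV[R]_m :=
  [set x | exists2 y, S y & direction S (x - y)].

Definition relative_interior S : set 'rV[R]_m :=
  [set x | S x /\ within (affine_hull S) (nbhs x) S].

Definition relative_boundary S : set 'rV[R]_m :=
  closure S `\` relative_interior S.

(* v is tangent to K and leaves K through the relative interior of F, while
   -v enters K there; in particular v is not tangent to F. *)
Definition outward K F v : Prop :=
  direction K v /\
  forall x, relative_interior F x ->
    \forall t \near 0^'+, K (x - t *: v) /\ ~ K (x + t *: v).

(* The sequence b has sign s in the facet F of K for the boundary orientation,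
   where K is oriented by E. *)
Definition boundary_oriented (s : int) K F (E b : seq 'rV[R]_m) : Prop :=
  [/\ forall u, u \in b -> direction F u,
      exists v, outward K F v
    & forall v, outward K F v -> oriented s E (v :: b)].

End Polytopes.

(* Formal composites of the operations m_k are planar trees, with leaves the
   identity and a node of label k and k children for m_k; linear combinations
   of composites live in the free abelian group on these trees. *)
Definition op_id : GenTree.tree unit := GenTree.Leaf tt.

Definition op_m k (args : seq (GenTree.tree unit)) : GenTree.tree unit :=
  GenTree.Node k args.

Definition op_comp i1 i2 i3 : GenTree.tree unit :=
  op_m (i1 + 1 + i3)
    (nseq i1 op_id ++ op_m i2 (nseq i2 op_id) :: nseq i3 op_id).

(* The right-hand side of the equation
     [m_1, m_n] = - sum (-1)^(i1 + i2 i3) m_(i1+1+i3)(id^i1, m_i2, id^i3)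
   of the sign conventions (B) for A-infinity algebras. *)
Definition ainf_rhsB n : {freeg (GenTree.tree unit) / int} :=
  - \sum_(i1 < n.+1) \sum_(i2 < n.+1)
      \sum_(i3 < n.+1 | admissible n i1 i2 i3)
        << ((-1) ^+ (i1 + i2 * i3)) *g op_comp i1 i2 i3 >>.

(* Main.v *)
Require Import Defs.
From HB Require Import structures.
From mathcomp Require Import all_boot all_order all_algebra.
From mathcomp Require Import all_classical all_reals all_analysis.
From mathcomp Require Import perm freeg.
From mathcomp Require Import zify ring lra.

Set Implicit Arguments.
Unset Strict Implicit.
Unset Printing Implicit Defensive.

Import Order.TTheory GRing.Theory Num.Theory numFieldNormedType.Exports.

Local Open Scope classical_set_scope.
Local Open Scope ring_scope.

(* The half-spaces D bound the sums of x over ranges of consecutive coordinates.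
   Under theta such a sum is a range sum of x plus a range sum of y, and
   2 * pair_sum = (sum of weights)^2 - sum of squares turns all comparisons of
   bounds into quadratic inequalities; this identifies each facet with a product.
   K_n and its facets have explicit points where all the other inequalities are
   strict, hence their directions and relative interiors are the expected ones,
   and a vector is outward for a facet iff its coordinates sum to 0 and its block
   sum is negative.  As the sign of a basis (v, b) does not depend on the outward
   vector v, it suffices to take v = theta (d_0) (- d_0): after permuting runs of
   rows, the matrix of (v, theta_basis) in the coordinates of K_n is triangular,
   and its determinant is - (-1)^(i1 + i2 i3). *)

(** * Polyhedra with a strictly interior point *)

Lemma near_right_affine_gt (R : realType) (a b c : R) :
  a < b -> \forall t \near 0^'+, a < b + t * c.
Proof.
move=> ab; near=> t.
have t0 : 0 < t by near: t; exact: nbhs_right_gt.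
(* The summand 1 keeps the denominator of the threshold positive when c = 0. *)
have c0 : 0 < `|c| + 1 by rewrite ltr_wpDl.
have tl : t < (b - a) / (`|c| + 1).
  by near: t; apply: nbhs_right_lt; rewrite divr_gt0 ?subr_gt0.
have : t * - c <= t * `|c| by rewrite ler_pM2l// -normrN ler_norm.
rewrite ltr_pdivlMr// mulrDr mulr1 in tl; rewrite mulrN; lra.
Unshelve. all: by end_near. Qed.

Section Polyhedron.
Variables (R : realType) (m : nat) (I : Type) (J : finType) (P : pred J).
Variables (f : I -> {scalar 'rV[R]_m}) (c : I -> R).
Variables (g : J -> {scalar 'rV[R]_m}) (d : J -> R).
Hypothesis fC : forall i, continuous (f i : 'rV[R]_m -> R).
Hypothesis gC : forall j, continuous (g j : 'rV[R]_m -> R).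

(** The inequalities have a finite index type, so that conditions valid near a point for each of
    them hold simultaneously. The predicate [P] lets a polytope and its facets share the same
    families [g] and [d]. *)
Definition polyhedron : set 'rV[R]_m :=
  [set x | (forall i, f i x = c i) /\ forall j, P j -> d j <= g j x].

Definition strict_point : set 'rV[R]_m :=
  [set x | (forall i, f i x = c i) /\ forall j, P j -> d j < g j x].

Lemma strict_pointW x : strict_point x -> polyhedron x.
Proof. by case=> fx gx; split=> // j /gx/ltW. Qed.

Lemma near_right_strict_point p u : strict_point p ->
  (forall i, f i u = 0) -> \forall t \near 0^'+, strict_point (p + t *: u).
Proof.
move=> [fp gp] fu.
have gt : \forall t \near (0 : R)^'+, forall j, P j -> d j < g j p + t * g j u.
  apply: filter_forall => j; case: (boolP (P j)) => [Pj|_]; last by apply: nearW.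
  by apply: filterS (near_right_affine_gt (g j u) (gp j Pj)) => t ? _.
apply: filterS gt => t gt; split=> [i|j Pj]; rewrite linearD linearZ /=.
  by rewrite fp fu mulr0 addr0.
exact: gt.
Qed.

Lemma near_strict_point p : strict_point p ->
  \forall y \near p, (forall i, f i y = c i) -> strict_point y.
Proof.
move=> [fp gp].
have gt : \forall y \near p, forall j, P j -> d j < g j y.
  apply: (@filter_forall _ J (fun j y => P j -> d j < g j y) (nbhs p)) => j.
  case: (boolP (P j)) => [Pj|_]; last by apply: nearW.
  have gj : \forall y \near p, d j < g j y.
    exact: (cvgr_gt _ (@gC j p) _ (gp j Pj)).
  by apply: filterS gj.
by apply: filterS gt => y gy fy; split.
Qed.

Lemma closed_polyhedron : closed polyhedron.
Proof.
rewrite (_ : polyhedron = (\bigcap_(i in setT) (f i @^-1` [set x | x = c i])) `&`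
    (\bigcap_(j in [set j | P j]) (g j @^-1` [set x | d j <= x]))).
  apply: closedI; apply: closed_bigI => i _; apply: preimage_closed.
  - by move=> x _; exact: fC.
  - exact: closed_eq.
  - by move=> x _; exact: gC.
  - exact: closed_ge.
apply/seteqP; split=> x [fx gx]; split=> i; first by move=> _; exact: fx.
- exact: gx.
- exact: fx.
- exact: gx.
Qed.

Variable p : 'rV[R]_m.
Hypothesis p_strict : strict_point p.

(** A strict point can be moved a little along any vector killed by the equations, so a small
    multiple of that vector is a difference of two points of the polyhedron. *)
Lemma direction_polyhedron : direction polyhedron = [set u | forall i, f i u = 0].
Proof.
apply/seteqP; split=> u /=.
  move=> [X Xd uX] i.
  have -> := coord_span (X := in_tuple X) uX.
  rewrite linear_sum big1//= => k _; rewrite linearZ /=.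
  have /Xd [x [y [[fx _] [fy _] ->]]] : X`_k \in X by exact: mem_nth.
  by rewrite linearB /= fx fy subrr mulr0.
move=> fu.
have [t [t0 Kt]] : exists t : R, 0 < t /\ strict_point (p + t *: u).
  near (0 : R)^'+ => t; exists t; split; first by near: t; exact: nbhs_right_gt.
  by near: t; exact: near_right_strict_point.
exists [:: t *: u].
  move=> v; rewrite inE => /eqP ->; exists (p + t *: u), p.
  by split; [exact: strict_pointW|exact: strict_pointW|rewrite addrC addKr].
rewrite span_seq1; apply/vlineP; exists t^-1.
by rewrite scalerA mulVf ?scale1r ?gt_eqF.
Unshelve. all: by end_near. Qed.

Lemma affine_hull_polyhedron :
  affine_hull polyhedron = [set x | forall i, f i x = c i].
Proof.
apply/seteqP; split=> x /=.
  case=> y [fy _]; rewrite direction_polyhedron /= => fxy i.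
  by have := fxy i; rewrite linearB fy => /subr0_eq.
move=> fx; exists p; first exact: strict_pointW.
by rewrite direction_polyhedron => i /=; rewrite linearB /= fx (p_strict.1 i) subrr.
Qed.

(* A relative interior point can be moved slightly away from the strict point p
   without leaving the polyhedron. *)
Lemma relative_interior_polyhedron : relative_interior polyhedron = strict_point.
Proof.
rewrite /relative_interior affine_hull_polyhedron.
apply/seteqP; split=> x /=.
  case=> [[fx gx] xint]; split=> // j Pj.
  rewrite lt_neqAle gx// andbT; apply/eqP => djE.
  have line : x + t *: (x - p) @[t --> (0 : R)] --> x.
    have xE : x = x + 0 *: (x - p) by rewrite scale0r addr0.
    rewrite [X in _ --> X]xE.
    by apply: cvgD; [exact: cvg_cst|apply: cvgZr_tmp; exact: cvg_id].
  have Kline : \forall t \near (0 : R)^'+,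
      (forall i, f i (x + t *: (x - p)) = c i) -> polyhedron (x + t *: (x - p)).
    exact: cvg_at_right_filter line _ xint.
  near (0 : R)^'+ => t.
  have t0 : 0 < t by near: t; exact: nbhs_right_gt.
  have : polyhedron (x + t *: (x - p)).
    have fline i : f i (x + t *: (x - p)) = c i.
      by rewrite linearD linearZ linearB /= fx (p_strict.1 i) subrr mulr0 addr0.
    by move: fline; near: t.
  case=> _ /(_ j Pj); rewrite linearD linearZ linearB /= -djE.
  by have := p_strict.2 j Pj; nra.
move=> xs; split; first exact: strict_pointW.
rewrite /within /=; apply: filterS (near_strict_point xs) => y ys fy.
exact/strict_pointW/ys.
Unshelve. all: by end_near. Qed.

(** The polyhedron is closed and its relative interior consists of the strict points, so exactly the
    points with some tight inequality remain. *)
Lemma relative_boundary_polyhedron :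
  relative_boundary polyhedron =
  [set x | polyhedron x /\ exists2 j, P j & g j x = d j].
Proof.
rewrite /relative_boundary -(closure_id _).1; last exact: closed_polyhedron.
rewrite relative_interior_polyhedron.
apply/seteqP; split=> x /=.
  case=> Kx Nx; split=> //; apply: contrapT => /forall2NP Nj.
  apply: Nx; split=> [|j Pj]; first exact: Kx.1.
  rewrite lt_neqAle Kx.2// andbT eq_sym; apply/eqP => gj.
  by case: (Nj j).
case=> Kx [j Pj gj]; split=> // -[_ /(_ j Pj)].
by rewrite gj ltxx.
Qed.

End Polyhedron.
(** * Bounds of the Loday half-spaces *)

Section PairSum.
Local Open Scope nat_scope.

Lemma big_ord_range (T : nmodType) n (F : nat -> T) (a b : nat) : b <= n ->
  (\sum_(k < n | (a <= k < b)%N) F k = \sum_(a <= k < b) F k)%R.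
Proof.
move=> bn; rewrite -(big_mkord (fun k => a <= k < b) F) [RHS]big_nat_cond.
have [ab|/ltnW ba] := leqP a b; last first.
  by rewrite !big_pred0 => // k; apply/negP; lia.
rewrite (@big_cat_nat _ _ _ b)//= (@big_cat_nat _ _ _ a)//=.
rewrite [X in (X + _ + _)%R]big_nat_cond [X in (_ + X + _)%R]big_nat_cond.
rewrite [X in (_ + _ + X)%R]big_nat_cond.
rewrite [X in (X + _ + _)%R]big_pred0 ?[X in (_ + _ + X)%R]big_pred0
  ?GRing.addr0 ?GRing.add0r.
- by apply: eq_bigl => k; lia.
- by move=> k; apply/negP; lia.
- by move=> k; apply/negP; lia.
Qed.

(** In the square, expanded as a double sum, the terms with k < l give one copy of [pair_sum]; by
    symmetry the terms with k >= l give a second copy and the diagonal. The additive form with a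
    factor 2 avoids subtraction and division in the natural numbers. *)
Lemma pair_sum_sqr n (w : n.-tuple nat) a b :
  2 * pair_sum w a b + \sum_(k < n | a <= k < b) tnth w k ^ 2 =
  (\sum_(k < n | a <= k < b) tnth w k) ^ 2.
Proof.
rewrite -mulnn big_distrlr /=.
have -> : pair_sum w a b = \sum_(k < n | a <= k < b)
    \sum_(l < n | (a <= l < b) && (k < l)) tnth w k * tnth w l.
  rewrite /pair_sum [RHS]big_mkcond /=; apply: eq_bigr => k _.
  case: ifP => kab; first by apply: eq_bigl => l; lia.
  by apply: big_pred0 => l; apply/negP; lia.
rewrite mul2n -addnn -addnA.
have -> : \sum_(k < n | a <= k < b)
    \sum_(l < n | (a <= l < b) && (k < l)) tnth w k * tnth w l +
    \sum_(k < n | a <= k < b) tnth w k ^ 2 =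
  \sum_(k < n | a <= k < b)
    \sum_(l < n | (a <= l < b) && ~~ (k < l)) tnth w k * tnth w l.
  rewrite (exchange_big_dep (fun k : 'I_n => a <= k < b)) /=; last by move=> *; lia.
  rewrite -big_split /=; apply: eq_bigr => k kab.
  rewrite [RHS](bigD1 k) /=; last by rewrite kab ltnn.
  rewrite addnC -mulnn; congr (_ + _).
  apply: eq_big => [l|l _]; last by rewrite mulnC.
  by rewrite -val_eqE /=; lia.
rewrite -big_split /=; apply: eq_bigr => k kab.
by rewrite [RHS](bigID (fun l : 'I_n => k < l)).
Qed.

Lemma pair_sum_weight1 n a b : b <= n ->
  2 * pair_sum (weight1 n) a b + (b - a) = (b - a) ^ 2.
Proof.
move=> bn; have w1 k : tnth (weight1 n) k = 1.
  by rewrite (tnth_nth 0) nth_nseq ltn_ord.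
have := pair_sum_sqr (weight1 n) a b.
rewrite (eq_bigr (fun=> 1)); last by move=> k _; rewrite w1.
rewrite [in RHS](eq_bigr (fun=> 1)); last by move=> k _; rewrite w1.
by rewrite !(@big_ord_range nat _ (fun=> _))// !sum_nat_const_nat !muln1.
Qed.

Lemma wtilde_weight1 n i1 i2 : i1 + i2 <= n ->
  wtilde (weight1 n) i1 i2 = weight1 i2.
Proof.
move=> le; apply: eq_from_tnth => j; have := ltn_ord j.
by rewrite tnth_mktuple /= (tnth_nth 0) !nth_nseq => ?; rewrite !ifT//; lia.
Qed.

(** The merged weight [i2] is written as 1 plus an excess [i2.-1], so that sums over a range become
    its length plus a multiple of an indicator. *)
Lemma wbar_weight1 n i1 i2 i3 j : i1 + i2 + i3 = n -> 0 < i2 ->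
  tnth (wbar (weight1 n) i1 i2 i3) j = 1 + i2.-1 * (j == i1 :> nat).
Proof.
move=> nE i2p; have := ltn_ord j; rewrite tnth_mktuple /= !nth_nseq => jlt.
case: ltngtP => ji1; rewrite ?muln0 ?ifT//; try lia.
rewrite (@eq_big_nat _ _ _ _ _ _ (fun=> 1)) ?sum_nat_const_nat; first by lia.
by move=> k kb; rewrite nth_nseq ifT//; lia.
Qed.

(** Here [s] is the excess of the total weight over the length of the range. The term [s * i2.+1] is
    the excess of the sum of squares, because i2^2 - 1 = (i2 - 1) (i2 + 1). *)
Lemma pair_sum_wbar n i1 i2 i3 a b : i1 + i2 + i3 = n -> 0 < i2 -> b <= i1.+1 + i3 ->
  let s := i2.-1 * (a <= i1 < b) in
  2 * pair_sum (wbar (weight1 n) i1 i2 i3) a b + (b - a) + s * i2.+1 = (b - a + s) ^ 2.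
Proof.
move=> nE i2p bm /=.
have i1m : i1 < i1.+1 + i3 by lia.
have delta : \sum_(k < i1.+1 + i3 | a <= k < b) (k == i1 :> nat) = (a <= i1 < b).
  rewrite big_mkcond (bigD1 (Ordinal i1m))//= eqxx big1 ?addn0; first by case: ifP.
  move=> k; rewrite -val_eqE /= => /negbTE ->; exact: if_same.
have := pair_sum_sqr (wbar (weight1 n) i1 i2 i3) a b.
have -> : \sum_(k < i1.+1 + i3 | a <= k < b) tnth (wbar (weight1 n) i1 i2 i3) k ^ 2 =
    b - a + (i2.-1 * i2.+1) * (a <= i1 < b).
  rewrite -delta big_distrr /= -[b - a]muln1 -sum_nat_const_nat -(big_ord_range _ _ bm).
  rewrite -big_split /=; apply: eq_bigr => k _.
  by rewrite wbar_weight1//; case: eqP => _ //=; rewrite ?muln0 ?muln1//; nia.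
have -> : \sum_(k < i1.+1 + i3 | a <= k < b) tnth (wbar (weight1 n) i1 i2 i3) k =
    b - a + i2.-1 * (a <= i1 < b).
  rewrite -delta big_distrr /= -[b - a]muln1 -sum_nat_const_nat -(big_ord_range _ _ bm).
  rewrite -big_split /=; apply: eq_bigr => k _.
  by rewrite wbar_weight1.
by move=> <-; nia.
Qed.

End PairSum.
(** * Range sums and the map theta *)

(** A version of [block_sum] with free end points: [block_sum i1 i2] is [rsum i1 (i1 + i2).-1] by
    conversion. Unlike the former it describes the total sum and single coordinates as well. *)
Definition rsum (R : realType) (m a b : nat) (x : 'rV[R]_m) : R :=
  \sum_(j < m | (a <= j < b)%N) x 0 j.
Arguments rsum {R m} a b x.

Lemma rsum_is_linear (R : realType) (m a b : nat) : scalar (@rsum R m a b).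
Proof.
move=> k x y; rewrite /rsum mulr_sumr -big_split /=.
by apply: eq_bigr => j _; rewrite !mxE.
Qed.

HB.instance Definition _ (R : realType) (m a b : nat) :=
  GRing.isLinear.Build R 'rV[R]_m R _ (@rsum R m a b) (@rsum_is_linear R m a b).

(** Coordinates as range sums inherit linearity, and their natural number indices need no casts
    between ordinal types; out of range the value is 0. *)
Notation entry k := (rsum (k : nat) k.+1).

Section RangeSums.
Variable R : realType.

Lemma rsum_continuous m a b : continuous (@rsum R m a b).
Proof.
apply: (@continuous_big _ _ +%R) => [|j _]; first exact: add_continuous.
exact: coord_continuous.
Qed.

Lemma rsum_cat m a b c (x : 'rV[R]_m) : (a <= b)%N -> (b <= c)%N ->
  rsum a c x = rsum a b x + rsum b c x.
Proof.
move=> ab bc; rewrite /rsum (bigID (fun j : 'I_m => (j < b)%N)) /=.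
by congr (_ + _); apply: eq_bigl => j; lia.
Qed.

Lemma rsum_geq m a b (x : 'rV[R]_m) : (b <= a)%N -> rsum a b x = 0.
Proof. by move=> ba; apply: big_pred0 => j; apply/negP; lia. Qed.

Lemma rsumT m (x : 'rV[R]_m) : rsum 0 m x = \sum_j x 0 j.
Proof. by apply: eq_bigl => j; rewrite ltn_ord. Qed.

Lemma entryE m (x : 'rV[R]_m) (j : 'I_m) : entry j x = x 0 j.
Proof. by rewrite /rsum (big_pred1 j)// => k /=; rewrite -val_eqE /=; lia. Qed.

Lemma entry_geq m (x : 'rV[R]_m) k : (m <= k)%N -> entry k x = 0.
Proof.
by move=> mk; apply: big_pred0 => j; have := ltn_ord j => ?; apply/negP; lia.
Qed.

Lemma entry_inj m (x y : 'rV[R]_m) :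
  (forall k, (k < m)%N -> entry k x = entry k y) -> x = y.
Proof. by move=> xy; apply/rowP => j; rewrite -!entryE xy. Qed.

Lemma rsum_const m a b (c : R) : (b <= m)%N ->
  rsum a b (const_mx c : 'rV[R]_m) = c *+ (b - a).
Proof.
move=> bm; rewrite /rsum (eq_bigr (fun=> c)); last by move=> j _; rewrite mxE.
by rewrite (@big_ord_range _ _ (fun=> c))// sumr_const_nat.
Qed.

Lemma entry_row m (F : nat -> R) k : (k < m)%N ->
  entry k (\row_(j < m) F j) = F k.
Proof. by move=> km; rewrite -[k]/(nat_of_ord (Ordinal km)) entryE mxE. Qed.

Lemma entry_row_mx p q (u : 'rV[R]_p) (v : 'rV[R]_q) k :
  entry k (row_mx u v) = if (k < p)%N then entry k u else entry (k - p) v.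
Proof.
case: ltnP => kp.
  rewrite [LHS](entryE _ (lshift q (Ordinal kp))) row_mxEl.
  by rewrite -[k]/(nat_of_ord (Ordinal kp)) entryE.
have [kq|qk] := ltnP (k - p) q; last by rewrite !entry_geq//; lia.
have kE : k = rshift p (Ordinal kq) by rewrite /= subnKC.
by rewrite [in LHS]kE -[(k - p)%N]/(nat_of_ord (Ordinal kq)) !entryE row_mxEr.
Qed.

Lemma entry_lsubmx p q (x : 'rV[R]_(p + q)) k : (k < p)%N ->
  entry k (lsubmx x) = entry k x.
Proof.
move=> kp; rewrite -[k]/(nat_of_ord (Ordinal kp)) entryE mxE -entryE.
by rewrite /=.
Qed.

Lemma entry_rsubmx p q (x : 'rV[R]_(p + q)) k :
  entry k (rsubmx x) = entry (p + k) x.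
Proof.
have [kq|qk] := ltnP k q; last by rewrite !entry_geq//; lia.
by rewrite -[k]/(nat_of_ord (Ordinal kq)) entryE mxE -entryE.
Qed.

Lemma entry_conform_mx p q (x : 'rV[R]_p) k : p = q ->
  entry k (conform_mx (0 : 'rV[R]_q) x) = entry k x.
Proof. by move=> <-; rewrite conform_mx_id. Qed.

(** The triple (i1, i2, i3) becomes the coordinate range from a = i1 up to, but excluding, b = i1 +
    i2 - 1. The full range, ruled out by i2 <= n - 1, may be included because the hyperplane
    equation gives equality there. *)
Lemma lodayP n (w : n.-tuple nat) (x : 'rV[R]_n.-1) : loday R w x <->
  rsum 0 n.-1 x = (pair_sum w 0 n)%:R /\
  forall a b, (a < b <= n.-1)%N -> (pair_sum w a b.+1)%:R <= rsum a b x.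
Proof.
rewrite /loday /= -rsumT; split=> -[xT xge]; split=> //.
  move=> a b /andP[ab bn].
  have [/andP[/eqP -> /eqP ->]|abT] := boolP ((a == 0%N) && (b == n.-1)).
    by rewrite xT prednK//; lia.
  have := xge a (b - a).+1 (n - b.+1)%N.
  rewrite /block_sum addnS subnKC ?(ltnW ab)//=; apply.
  by rewrite /admissible; lia.
move=> i1 i2 i3 /and3P[/eqP nE i2_gt1 i2n].
have := xge i1 (i1 + i2).-1; rewrite prednK; last by lia.
by apply; lia.
Qed.

End RangeSums.

Section BlockIndices.
Variables i1 i2 : nat.

(* Among the first a coordinates of theta x y, the first [x_index a] ones of x
   and the first [y_index a] ones of y occur. *)
Definition x_index a := (minn a i1 + (a - (i1 + i2.-1)))%N.
Definition y_index a := minn (a - i1) i2.-1.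

Lemma x_index_add_y_index a : (x_index a + y_index a = a)%N.
Proof. by rewrite /x_index /y_index; lia. Qed.

Lemma x_index_homo a b : (a <= b)%N -> (x_index a <= x_index b)%N.
Proof. by rewrite /x_index; lia. Qed.

Lemma y_index_homo a b : (a <= b)%N -> (y_index a <= y_index b)%N.
Proof. by rewrite /y_index; lia. Qed.

End BlockIndices.

Section Theta.
Variables (R : realType) (n i1 i2 i3 : nat).
Hypotheses (i2_gt1 : (1 < i2)%N) (nE : (i1 + i2 + i3)%N = n).
Implicit Types (x : 'rV[R]_(i1 + i3)) (y : 'rV[R]_i2.-1).

Lemma entry_theta x y k : entry k (theta n i1 i2 i3 x y) =
  if (k < i1)%N then entry k x
  else if (k < i1 + i2.-1)%N then entry (k - i1) y else entry (k - i2.-1) x.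
Proof.
rewrite entry_conform_mx; last by lia.
rewrite entry_row_mx; case: ltnP => ki1; first by rewrite entry_lsubmx.
rewrite entry_row_mx ltn_subLR//; case: ltnP => // kp.
by rewrite entry_rsubmx; congr (rsum _ _ x); lia.
Qed.

Lemma theta_linear_x : linear (fun x : 'rV[R]_(i1 + i3) => theta n i1 i2 i3 x 0).
Proof.
move=> c x x'; apply: entry_inj => k _.
rewrite [RHS]linearP /= !entry_theta linear0; case: ifP => _; first exact: linearP.
by case: ifP => _; [rewrite mulr0 addr0|exact: linearP].
Qed.

Lemma theta_linear_y : linear (fun y : 'rV[R]_i2.-1 => theta n i1 i2 i3 0 y).
Proof.
move=> c y y'; apply: entry_inj => k _.
rewrite [RHS]linearP /= !entry_theta !linear0.
case: ifP => _; first by rewrite mulr0 addr0.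
by case: ifP => _; [exact: linearP|rewrite mulr0 addr0].
Qed.

Lemma theta0 : theta n i1 i2 i3 0 0 = 0 :> 'rV[R]_n.-1.
Proof.
apply: entry_inj => k _; rewrite entry_theta [RHS]linear0.
by case: ifP => _; [|case: ifP => _]; exact: linear0.
Qed.

Lemma theta_split x y :
  theta n i1 i2 i3 x y = theta n i1 i2 i3 x 0 + theta n i1 i2 i3 0 y.
Proof.
apply: entry_inj => k _; rewrite [RHS]linearD /= !entry_theta.
by case: ifP => _; [|case: ifP => _]; rewrite linear0 ?addr0 ?add0r.
Qed.

Lemma thetaP z : exists x y, z = theta n i1 i2 i3 x y.
Proof.
pose F j := entry (if j < i1 then j else j + i2.-1)%N z.
exists (\row_(j < i1 + i3) F j), (\row_(j < i2.-1) entry (i1 + j) z).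
apply: entry_inj => k km; rewrite entry_theta.
case: ltnP => ki1; first by rewrite entry_row /F ?ki1//; lia.
case: ltnP => kp; first by rewrite (entry_row (fun j => entry (i1 + j) z)) ?subnKC//; lia.
by rewrite entry_row /F ?ifF ?subnK//; lia.
Qed.

(** By induction on the right end point: the added coordinate lies before, inside or after the
    block, and advances exactly one of the two indices. *)
Lemma rsum_theta x y a b : (a <= b)%N ->
  rsum a b (theta n i1 i2 i3 x y) =
  rsum (x_index i1 i2 a) (x_index i1 i2 b) x + rsum (y_index i1 i2 a) (y_index i1 i2 b) y.
Proof.
elim: b => [|b IHb]; first by rewrite leqn0 => /eqP ->; rewrite !rsum_geq ?addr0.
rewrite leq_eqVlt => /predU1P[->|]; first by rewrite !rsum_geq ?addr0.
rewrite ltnS => ab.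
rewrite (rsum_cat _ ab (leqnSn b)) IHb// entry_theta.
case: ltnP => bi1; last case: ltnP => bp.
- have -> : y_index i1 i2 b.+1 = y_index i1 i2 b by rewrite /y_index; lia.
  have -> : x_index i1 i2 b.+1 = b.+1 by rewrite /x_index; lia.
  have -> : x_index i1 i2 b = b by rewrite /x_index; lia.
  rewrite addrAC; congr (_ + _); rewrite [RHS](rsum_cat (b := b) (c := b.+1))//.
  by rewrite /x_index; lia.
- have -> : x_index i1 i2 b.+1 = x_index i1 i2 b by rewrite /x_index; lia.
  have -> : y_index i1 i2 b.+1 = (b - i1).+1 by rewrite /y_index; lia.
  have -> : y_index i1 i2 b = (b - i1)%N by rewrite /y_index; lia.
  rewrite -addrA; congr (_ + _); rewrite [RHS](rsum_cat (b := b - i1))//.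
  by rewrite /y_index; lia.
- have -> : y_index i1 i2 b.+1 = y_index i1 i2 b by rewrite /y_index; lia.
  have -> : x_index i1 i2 b.+1 = (b - i2.-1).+1 by rewrite /x_index; lia.
  have -> : x_index i1 i2 b = (b - i2.-1)%N by rewrite /x_index; lia.
  rewrite addrAC; congr (_ + _).
  rewrite [RHS](rsum_cat (b := (b - i2.-1)%N) (c := (b - i2.-1).+1))//.
  by rewrite /x_index; lia.
Qed.

End Theta.
(** * Facets are products *)

Lemma pair_sum_weight1_shift n n' a b a' b' : (b <= n)%N -> (b' <= n')%N ->
  (b - a = b' - a')%N ->
  pair_sum (weight1 n) a b = pair_sum (weight1 n') a' b'.
Proof.
move=> bn bn' ab; have := pair_sum_weight1 a bn; have := pair_sum_weight1 a' bn'.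
by rewrite ab; lia.
Qed.

Section FacetProduct.
Variables (R : realType) (n i1 i2 i3 : nat).
Hypothesis adm : admissible n i1 i2 i3.
Let i2_gt1 : (1 < i2)%N. Proof. by case/and3P: adm. Qed.
Let nE : (i1 + i2 + i3)%N = n. Proof. by case/and3P: adm => /eqP. Qed.
Let i2_lt : (i2 < n)%N. Proof. by case/and3P: adm; lia. Qed.

Local Notation theta := (@theta R n i1 i2 i3).
Local Notation ones := (pair_sum (weight1 n)).
Local Notation wb := (wbar (weight1 n) i1 i2 i3).

Lemma rsum_theta_y x y a b : (a <= b <= i2.-1)%N ->
  rsum (i1 + a) (i1 + b) (theta x y) = rsum a b y.
Proof.
move=> ab; rewrite rsum_theta//; last by lia.
rewrite [X in X + _]rsum_geq ?add0r; last by rewrite /x_index; lia.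
have -> : y_index i1 i2 (i1 + a) = a by rewrite /y_index; lia.
by have -> : y_index i1 i2 (i1 + b) = b by rewrite /y_index; lia.
Qed.

Lemma rsum_thetaT x y :
  rsum 0 n.-1 (theta x y) = rsum 0 (i1 + i3) x + rsum 0 i2.-1 y.
Proof.
rewrite rsum_theta//.
have -> : x_index i1 i2 0 = 0%N by rewrite /x_index; lia.
have -> : y_index i1 i2 0 = 0%N by rewrite /y_index; lia.
have -> : x_index i1 i2 n.-1 = (i1 + i3)%N by rewrite /x_index; lia.
by have -> : y_index i1 i2 n.-1 = i2.-1 by rewrite /y_index; lia.
Qed.

Lemma rsum_theta_block x y :
  rsum i1 (i1 + i2).-1 (theta x y) = rsum 0 i2.-1 y.
Proof.
rewrite -(@rsum_theta_y x y 0 i2.-1) ?addn0 ?leqnn//.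
by rewrite (_ : (i1 + i2).-1 = (i1 + i2.-1)%N)//; lia.
Qed.

(** The pairs of positions inside the block are counted by the last term; the contribution of all
    other pairs is unchanged when the block is merged into a single weight. *)
Lemma pair_sum_wbar_straddle a b : (a <= i1 <= b)%N -> (b <= i1 + i3)%N ->
  ones a (b + i2.-1).+1 = (pair_sum wb a b.+1 + ones i1 (i1 + i2))%N.
Proof.
move=> ab bm.
have hb : (b.+1 <= i1.+1 + i3)%N by lia.
have := pair_sum_wbar a nE (ltnW i2_gt1) hb.
have -> : (a <= i1 < b.+1)%N by lia.
have h1 : ((b + i2.-1).+1 <= n)%N by lia.
have h2 : (i1 + i2 <= n)%N by lia.
have := pair_sum_weight1 a h1; have := pair_sum_weight1 i1 h2.
have -> : ((b + i2.-1).+1 - a = b.+1 - a + i2.-1)%N by lia.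
have -> : (i1 + i2 - i1 = i2.-1 + 1)%N by lia.
by move: (i2.-1) (prednK (ltnW i2_gt1)) => p <-; nia.
Qed.

(** Away from the merged entry all weights of [wb] are 1. *)
Lemma pair_sum_wbar_disjoint a b : (b < i1)%N || (i1 < a)%N -> (b <= i1 + i3)%N ->
  ones a b.+1 = pair_sum wb a b.+1.
Proof.
move=> ab bm.
have hb : (b.+1 <= i1.+1 + i3)%N by lia.
have := pair_sum_wbar a nE (ltnW i2_gt1) hb.
have -> : (a <= i1 < b.+1)%N = false by lia.
have h1 : (b.+1 <= n)%N by lia.
by have := pair_sum_weight1 a h1; rewrite /=; lia.
Qed.

(* The inequality of K_n for a range meeting the block in c positions follows
   from that of the x-range [a, b), which touches i1, and that of the y-range. *)
Lemma pair_sum_overlap a b c : (a <= i1 <= b)%N -> (b <= i1 + i3)%N -> (c < i2)%N ->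
  (ones a (b + c).+1 <= pair_sum wb a b.+1 + ones i1 (i1 + c.+1))%N.
Proof.
move=> ab bm ci2.
have hb : (b.+1 <= i1.+1 + i3)%N by lia.
have := pair_sum_wbar a nE (ltnW i2_gt1) hb.
have -> : (a <= i1 < b.+1)%N by lia.
have h1 : ((b + c).+1 <= n)%N by lia.
have h2 : (i1 + c.+1 <= n)%N by lia.
have := pair_sum_weight1 a h1; have := pair_sum_weight1 i1 h2.
have [d dE] : exists d, (b.+1 - a = d.+1)%N by exists (b - a)%N; lia.
have -> : ((b + c).+1 - a = d.+1 + c)%N by lia.
have -> : (i1 + c.+1 - i1 = c.+1)%N by lia.
rewrite dE.
have [e eE] : exists e, (i2.-1 = c + e)%N by exists (i2.-1 - c)%N; lia.
by rewrite eE (_ : i2 = (c + e).+1); [nia|lia].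
Qed.

(** On the facet the sum of y over the whole block is fixed. Hence an inequality for x at a range
    touching [i1] is that of K_n at the range enlarged by the block, and the remaining ones only
    have to be shifted. Conversely, a range of K_n splits into a range of x and a range of y, and
    their two bounds together imply the required one. *)
Lemma facet_thetaP x y : loday_facet R (weight1 n) i1 i2 (theta x y) <->
  loday R wb x /\ loday R (weight1 i2) y.
Proof.
have blockE : ones i1 (i1 + i2) = pair_sum (weight1 i2) 0 i2.
  by apply: pair_sum_weight1_shift; lia.
have totalE : ones 0 n = (pair_sum wb 0 (i1.+1 + i3) + ones i1 (i1 + i2))%N.
  have i1le : (0 <= i1 <= i1 + i3)%N by rewrite leq_addr.
  have <- := pair_sum_wbar_straddle i1le (leqnn _).
  by congr (ones 0); lia.
split.
  case=> /lodayP[zT zge] /=; rewrite /block_sum -/(rsum _ _ _) rsum_theta_block => yT.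
  split; apply/lodayP; split.
  - apply: (@addIr _ (rsum 0 i2.-1 y)); rewrite -rsum_thetaT zT yT.
    by rewrite -natrD totalE.
  - move=> a b ab.
    have [abi1|abi1] := boolP ((a <= i1) && (i1 <= b))%N.
      rewrite -(lerD2r (rsum 0 i2.-1 y)).
      have -> : rsum a b x + rsum 0 i2.-1 y = rsum a (b + i2.-1) (theta x y).
        rewrite rsum_theta//; last by lia.
        by congr (rsum _ _ x + rsum _ _ y); rewrite /x_index /y_index; lia.
      by rewrite yT -natrD -pair_sum_wbar_straddle ?zge//; lia.
    rewrite -pair_sum_wbar_disjoint; [|by lia|by lia].
    have [bi1|i1b] := ltnP b i1.
      have -> : rsum a b x = rsum a b (theta x y).
        rewrite rsum_theta; [|by lia..].
        rewrite [X in _ + X]rsum_geq ?addr0; last by rewrite /y_index; lia.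
        by congr (rsum _ _ x); rewrite /x_index; lia.
      by apply: zge; lia.
    have -> : rsum a b x = rsum (a + i2.-1) (b + i2.-1) (theta x y).
      rewrite rsum_theta; [|by lia..].
      rewrite [X in _ + X]rsum_geq ?addr0; last by rewrite /y_index; lia.
      by congr (rsum _ _ x); rewrite /x_index; lia.
    rewrite (@pair_sum_weight1_shift _ n _ _ (a + i2.-1) (b + i2.-1).+1); [|by lia..].
    by apply: zge; lia.
  - by rewrite yT blockE.
  - move=> a b ab; rewrite -(rsum_theta_y x); last by lia.
    rewrite (@pair_sum_weight1_shift _ n _ _ (i1 + a) (i1 + b).+1); [|by lia..].
    by apply: zge; lia.
case=> /lodayP[/= xT xge] /lodayP[yT yge].
split=> /=; last by rewrite /block_sum -/(rsum _ _ _) rsum_theta_block yT blockE.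
apply/lodayP; split; first by rewrite rsum_thetaT xT yT totalE natrD blockE.
move=> a b ab; rewrite rsum_theta//; last by lia.
set a' := x_index _ _ a; set b' := x_index _ _ b.
set c := y_index _ _ a; set d := y_index _ _ b.
have bE : (b - a = b' - a' + (d - c))%N by rewrite /a' /b' /c /d /x_index /y_index; lia.
(* If no coordinate of x occurs, the range lies inside the block and the inequality is one for y. *)
have [ca'|a'b'] := leqP b' a'.
  rewrite (rsum_geq _ ca') add0r.
  rewrite (@pair_sum_weight1_shift _ i2 _ _ c d.+1).
  - by apply: yge; rewrite /a' /b' /c /d /x_index /y_index in ca' bE *; lia.
  - by lia.
  - by rewrite /d /y_index; lia.
  - by rewrite /a' /b' /c /d /x_index /y_index in ca' bE *; lia.
have b'le : (b' <= i1 + i3)%N by rewrite /b' /x_index; lia.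
have xab : (pair_sum wb a' b'.+1)%:R <= rsum a' b' x by apply: xge; lia.
have [dc|cd] := leqP d c.
  rewrite (rsum_geq _ dc) addr0; apply: le_trans xab; rewrite ler_nat.
  have [abi1|abi1] := boolP ((a' <= i1) && (i1 <= b'))%N.
    (* The range touches the edge of the block without entering it, yet its bound for [wb] involves
       the merged weight. With c = 0 the block term [ones i1 (i1 + 1)] runs over no pair and
       vanishes, so the bound for [wb] is the larger one. *)
    have := @pair_sum_overlap a' b' 0 abi1 b'le.
    have h : (i1 + 1 <= n)%N by lia.
    have := pair_sum_weight1 i1 h.
    rewrite (@pair_sum_weight1_shift _ n a b.+1 a' (b' + 0).+1); [|by lia..].
    by lia.
  rewrite -pair_sum_wbar_disjoint; [|by lia|by lia].
  rewrite (@pair_sum_weight1_shift _ n a b.+1 a' b'.+1)//; lia.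
have ydc : (pair_sum (weight1 i2) c d.+1)%:R <= rsum c d y.
  by apply: yge; rewrite /d /y_index in cd *; lia.
apply: le_trans (lerD xab ydc); rewrite -natrD ler_nat.
(* A range with coordinates of both x and y crosses an edge of the block, so its part in x touches
   [i1]. *)
have abi1 : (a' <= i1 <= b')%N.
  by rewrite /a' /b' /c /d /x_index /y_index in a'b' cd *; lia.
have dci2 : (d - c < i2)%N by rewrite /d /y_index; lia.
have := @pair_sum_overlap a' b' (d - c) abi1 b'le dci2.
rewrite (@pair_sum_weight1_shift _ n a b.+1 a' (b' + (d - c)).+1); [|by lia..].
have di2 : (d.+1 <= i2)%N by rewrite /d /y_index; lia.
by rewrite (@pair_sum_weight1_shift n i2 i1 (i1 + (d - c).+1) c d.+1) => //; lia.
Qed.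

Lemma loday_facetE : loday_facet R (weight1 n) i1 i2 =
  theta_prod n i1 i2 i3 (loday R wb) (loday R (wtilde (weight1 n) i1 i2)).
Proof.
rewrite wtilde_weight1; last by lia.
apply/seteqP; split=> z.
  have [x [y ->]] := thetaP i2_gt1 nE z.
  by move=> /facet_thetaP[Kx Ky]; exists (x, y).
by case=> -[x y] [/= Kx Ky] <-; apply/facet_thetaP.
Qed.

End FacetProduct.
(** * Boundary and outward vectors *)

Section FacetGeometry.
Variables (R : realType) (n : nat).
Local Notation ones := (pair_sum (weight1 n)).
Local Notation K := (loday R (weight1 n)).

(** The pair (a, b) stands for the triple with i1 = a and i2 = b - a + 1; the excluded full range
    would have i2 = n. Pairs of ordinals provide the finite index type required for a polyhedron. *)
Definition proper_range (t : 'I_n * 'I_n) : bool :=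
  (t.1 < t.2)%N && ~~ ((t.1 == 0 :> nat) && (t.2 == n.-1 :> nat)).

Definition range_sum (t : 'I_n * 'I_n) : {scalar 'rV[R]_n.-1} := rsum t.1 t.2.

Definition range_bound (t : 'I_n * 'I_n) : R := (ones t.1 t.2.+1)%:R.

Lemma pair_sum_weight1R a b : (a <= b < n)%N ->
  (ones a b.+1)%:R = (b - a)%:R * (b - a).+1%:R / 2 :> R.
Proof.
case/andP=> ab bn; have := pair_sum_weight1 a bn; rewrite subSn//.
move: (b - a)%N (ones _ _) => L N NE.
suff -> : (L%:R * L.+1%:R : R) = 2 * N%:R by rewrite mulrC mulKf// pnatr_eq0.
by rewrite -!natrM; congr (_%:R); nia.
Qed.

Lemma loday_polyhedron : (0 < n)%N ->
  K = polyhedron proper_range (fun _ : unit => rsum 0 n.-1)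
        (fun=> (ones 0 n)%:R) range_sum range_bound.
Proof.
move=> n0; apply/seteqP; split=> x; rewrite lodayP => -[xT xge]; split=> //.
- move=> [a b] /= /andP[/= ab _]; apply: xge => /=; have := ltn_ord b; lia.
- exact: xT tt.
move=> a b ab; have := xT tt => /= xT'.
have [abT|abT] := boolP ((a == 0%N) && (b == n.-1)).
  by case/andP: abT => /eqP -> /eqP ->; rewrite prednK// xT'.
have an : (a < n)%N by lia.
have bn : (b < n)%N by lia.
by apply: (xge (Ordinal an, Ordinal bn)); rewrite /proper_range /= abT; lia.
Qed.

(* All coordinates equal; then their value is forced by the total. *)
Definition interior_point : 'rV[R]_n.-1 := const_mx (n%:R / 2).

(** A range of length L has sum L n / 2, against the bound L (L + 1) / 2; among nonempty ranges only
    the full one has L + 1 = n. *)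
Lemma strict_interior_point : (0 < n)%N ->
  strict_point proper_range (fun _ : unit => rsum 0 n.-1)
    (fun=> (ones 0 n)%:R) range_sum range_bound interior_point.
Proof.
move=> n0; split=> [_|[a b] /andP[/= ab abT]].
  rewrite /interior_point /= rsum_const//.
  have -> : ones 0 n = ones 0 n.-1.+1 by rewrite prednK.
  rewrite pair_sum_weight1R; last by lia.
  by rewrite !subn0 prednK// -mulr_natr; ring.
have := ltn_ord a; have := ltn_ord b => bn an.
rewrite /range_sum /range_bound /interior_point /= rsum_const; last by lia.
rewrite pair_sum_weight1R; last by lia.
rewrite -[ltRHS]mulr_natr [ltRHS]mulrAC -!natrM ltr_pM2r ?invr_gt0 ?ltr0n// ltr_nat.
nia.
Qed.

Section Facet.
Variables i1 i2 i3 : nat.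
Hypothesis adm : admissible n i1 i2 i3.
Let i2_gt1 : (1 < i2)%N. Proof. by case/and3P: adm. Qed.
Let nE : (i1 + i2 + i3)%N = n. Proof. by case/and3P: adm => /eqP. Qed.
Let i2_lt : (i2 < n)%N. Proof. by case/and3P: adm; lia. Qed.
Local Notation F := (loday_facet R (weight1 n) i1 i2).
Local Notation block := (@rsum R n.-1 i1 (i1 + i2).-1).

(** The range of the block is removed because its inequality is an equation on the facet and can
    never be strict there. *)
Definition other_range (t : 'I_n * 'I_n) : bool :=
  proper_range t && ~~ ((t.1 == i1 :> nat) && (t.2 == (i1 + i2).-1 :> nat)).

Definition facet_form (e : bool) : {scalar 'rV[R]_n.-1} :=
  rsum (if e then 0%N else i1) (if e then n.-1 else (i1 + i2).-1).

Definition facet_value (e : bool) : R :=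
  if e then (ones 0 n)%:R else (ones i1 (i1 + i2))%:R.

Lemma facet_polyhedron :
  F = polyhedron other_range facet_form facet_value range_sum range_bound.
Proof.
rewrite /loday_facet loday_polyhedron; last by lia.
apply/seteqP; split=> x.
  case=> [[xT xge] xB]; split=> [[]|t /andP[/xge]//]; last exact: xB.
  exact: xT tt.
case=> [xT xge]; split; last exact: xT false.
split=> [_|[a b] abP]; first exact: xT true.
have [abB|abB] := boolP ((a == i1 :> nat) && (b == (i1 + i2).-1 :> nat)); last first.
  by apply: xge; rewrite /other_range abP.
case/andP: abB => /eqP aE /eqP bE.
rewrite /range_bound /range_sum /= aE bE prednK; last by lia.
by have /= -> := xT false.
Qed.

(* Constant outside and inside the block; both values are forced by the two
   equations of the facet. *)
Definition facet_point : 'rV[R]_n.-1 :=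
  theta n i1 i2 i3 (const_mx ((n + i2.-1)%:R / 2)) (const_mx (i2%:R / 2)).

Lemma rsum_facet_point a b : (a <= b < n)%N -> rsum a b facet_point =
  ((x_index i1 i2 b - x_index i1 i2 a) * (n + i2.-1) +
   (y_index i1 i2 b - y_index i1 i2 a) * i2)%:R / 2.
Proof.
move=> ab; rewrite /facet_point rsum_theta; [|by lia..].
rewrite !rsum_const; [|by rewrite /y_index; lia|by rewrite /x_index; lia].
by ring.
Qed.

(** The numbers c and d count the coordinates of a range inside and outside the block, out of p and
    q in all. With e = p - c and h = q - d, the right side minus the left side is exactly c e + d h
    + 2 d e, which vanishes only for the empty range, the block and the full range. *)
Lemma facet_point_bound p q c d : (c <= p)%N -> (d <= q)%N -> (0 < c + d)%N ->
  ~~ ((c == p) && (d == 0))%N -> ~~ ((c == p) && (d == q)) ->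
  ((c + d) * (c + d).+1 < d * (q + p.+1 + p) + c * p.+1)%N.
Proof.
move=> cp dq cd0 cd1 cd2.
have [e pE] : exists e, (p = c + e)%N by exists (p - c)%N; lia.
have [h qE] : exists h, (q = d + h)%N by exists (q - d)%N; lia.
have : (0 < c * e + d * h + 2 * (d * e))%N by nia.
by subst p q; nia.
Qed.

Lemma strict_facet_point :
  strict_point other_range facet_form facet_value range_sum range_bound facet_point.
Proof.
split=> [[]|[a b] /andP[/andP[/= ab abT] /= abB]].
- rewrite /= rsum_facet_point; last by lia.
  have n0 : (0 < n)%N by lia.
  have -> : ones 0 n = ones 0 n.-1.+1 by rewrite prednK.
  rewrite pair_sum_weight1R; last by lia.
  rewrite -natrM; congr (_%:R / _).
  have -> : (x_index i1 i2 n.-1 - x_index i1 i2 0 = n - i2)%N by rewrite /x_index; lia.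
  have -> : (y_index i1 i2 n.-1 - y_index i1 i2 0 = i2.-1)%N by rewrite /y_index; lia.
  have [p pE] : exists p, i2 = p.+1 by exists i2.-1; lia.
  have [q qE] : exists q, n = (q + p.+1)%N by exists (n - i2)%N; lia.
  by rewrite qE pE addnK addnS /= subn0; ring.
- rewrite /= rsum_facet_point; last by lia.
  have i12 : (0 < i1 + i2)%N by lia.
  rewrite -[X in ones _ X](prednK i12) pair_sum_weight1R; last by lia.
  rewrite -natrM; congr (_%:R / _).
  have -> : (x_index i1 i2 (i1 + i2).-1 - x_index i1 i2 i1 = 0)%N.
    by rewrite /x_index; lia.
  have -> : (y_index i1 i2 (i1 + i2).-1 - y_index i1 i2 i1 = i2.-1)%N.
    by rewrite /y_index; lia.
  have -> : ((i1 + i2).-1 - i1 = i2.-1)%N by lia.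
  by rewrite prednK ?(ltnW i2_gt1).
have := ltn_ord a; have := ltn_ord b => bn an.
rewrite /range_sum /range_bound /= rsum_facet_point; last by lia.
rewrite pair_sum_weight1R; last by lia.
rewrite -natrM ltr_pM2r ?invr_gt0 ?ltr0n// ltr_nat.
set d := (x_index _ _ _ - _)%N; set c := (y_index _ _ _ - _)%N.
have cdE : (b - a = c + d)%N.
  have := x_index_homo i1 i2 (ltnW ab); have := y_index_homo i1 i2 (ltnW ab).
  by have := x_index_add_y_index i1 i2 a; have := x_index_add_y_index i1 i2 b; lia.
have cp : (c <= i2.-1)%N by apply: leq_trans (leq_subr _ _) (geq_minr _ _).
have dq : (d <= n - i2)%N by rewrite /d /x_index; clear cdE cp; lia.
(* A range with the maximal number of block coordinates contains the block, so the two counts tell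
   whether it is the block or the full range. *)
have cP : c = i2.-1 -> (a <= i1)%N /\ (i1 + i2.-1 <= b)%N.
  by rewrite /c /y_index; clear - i2_gt1; lia.
rewrite cdE; have -> : (n + i2.-1 = (n - i2) + i2.-1.+1 + i2.-1)%N by lia.
have {4}-> : i2 = i2.-1.+1 by lia.
apply: facet_point_bound => //; first by lia.
  by apply/negP => /andP[/eqP /cP[ai1 i1b] /eqP d0]; lia.
by apply/negP => /andP[/eqP cE /eqP dE]; lia.
Qed.

Lemma direction_facet : direction F = [set u | rsum 0 n.-1 u = 0 /\ block u = 0].
Proof.
rewrite facet_polyhedron (direction_polyhedron strict_facet_point).
apply/seteqP; split=> u /=; first by move=> fu; split; [exact: fu true|exact: fu false].
by case=> uT uB [].
Qed.

(** At a relative interior point of the facet only the block inequality is tight, so for small t the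
    sign of [block v] alone decides which of the points x - t v and x + t v lie in [K]. *)
Lemma outwardP v : outward K F v <-> rsum 0 n.-1 v = 0 /\ block v < 0.
Proof.
have n0 : (0 < n)%N by lia.
rewrite /outward loday_polyhedron// (direction_polyhedron (strict_interior_point n0)).
rewrite -[polyhedron _ _ _ _ _]loday_polyhedron//.
rewrite facet_polyhedron (relative_interior_polyhedron _ strict_facet_point);
  last by move=> t; exact: rsum_continuous.
have Kblock x : K x -> (ones i1 (i1 + i2))%:R <= block x.
  by case=> _ /(_ i1 i2 i3 adm).
have FK x :
  strict_point other_range facet_form facet_value range_sum range_bound x -> K x.
  by move=> /strict_pointW; rewrite -facet_polyhedron => -[].
split.
  case=> /(_ tt) /= vT /(_ _ strict_facet_point) vout; split=> //.
  have pB : block facet_point = (ones i1 (i1 + i2))%:R := strict_facet_point.1 false.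
  have [vB|//] := leP 0 (block v); exfalso.
  (* With block sum 0 the point x + t v stays in the facet for small t; with positive block sum x -
     t v violates the block inequality. Both contradict outwardness at [facet_point]. *)
  have [vB0|vB0] := eqVneq (block v) 0.
    have vF e : facet_form e v = 0 by case: e.
    near (0 : R)^'+ => t.
    have [_] : K (facet_point - t *: v) /\ ~ K (facet_point + t *: v) by near: t.
    by apply; apply: FK; near: t; apply: near_right_strict_point strict_facet_point vF.
  near (0 : R)^'+ => t.
  have t0 : 0 < t by near: t; exact: nbhs_right_gt.
  have [/Kblock + _] : K (facet_point - t *: v) /\ ~ K (facet_point + t *: v) by near: t.
  rewrite linearB linearZ /= pB => tvB.
  have : t * block v > 0 by rewrite mulr_gt0// lt_neqAle eq_sym vB0.
  by move: tvB; lra.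
case=> vT vB; split=> [_ //|x [xT xgt]].
have xB : block x = (ones i1 (i1 + i2))%:R := xT false.
have gt : \forall t \near (0 : R)^'+, forall j, other_range j ->
    range_bound j < range_sum j x + t * range_sum j (- v).
  apply: filter_forall => j; case: (boolP (other_range j)) => [Pj|_]; last by apply: nearW.
  by apply: filterS (near_right_affine_gt (range_sum j (- v)) (xgt j Pj)) => t ? _.
near=> t.
have t0 : 0 < t by near: t; exact: nbhs_right_gt.
split; last first.
  move=> /Kblock; rewrite linearD linearZ /= xB.
  have : t * block v < 0 by rewrite pmulr_rlt0.
  lra.
rewrite loday_polyhedron//; split=> [_|[a b] abP].
  by have := xT true; rewrite linearB linearZ /= vT mulr0 subr0.
have [abB|abB] := boolP ((a == i1 :> nat) && (b == (i1 + i2).-1 :> nat)).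
  case/andP: abB => /eqP aE /eqP bE.
  rewrite /range_bound /range_sum /= aE bE prednK; last by lia.
  rewrite linearB linearZ /= xB.
  have : t * block v < 0 by rewrite pmulr_rlt0.
  lra.
rewrite -scalerN linearD linearZ /=; apply/ltW.
have abO : other_range (a, b) by rewrite /other_range abP.
have tgt : forall j, other_range j ->
  range_bound j < range_sum j x + t * range_sum j (- v) by near: t.
exact: tgt (a, b) abO.
Unshelve. all: by end_near. Qed.

End Facet.

Lemma relative_boundary_loday : (0 < n)%N -> relative_boundary K =
  [set x | exists i1 i2 i3, admissible n i1 i2 i3 /\ loday_facet R (weight1 n) i1 i2 x].
Proof.
move=> n0; rewrite loday_polyhedron//.
rewrite (relative_boundary_polyhedron _ _ (strict_interior_point n0)); last 2 first.
- by move=> _; exact: rsum_continuous.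
- by move=> t; exact: rsum_continuous.
rewrite -loday_polyhedron//; apply/seteqP; split=> x /=.
  case=> Kx [[a b] /andP[/= ab abT] xab].
  exists a, (b - a).+1, (n - b.+1)%N; have := ltn_ord b => bn.
  split; first by rewrite /admissible; lia.
  split=> //=; rewrite /block_sum -/(rsum _ _ _) addnS subnKC//= ?xab//.
  exact: ltnW.
case=> i1 [i2 [i3 [adm [Kx /= xB]]]]; split=> //.
have /and3P[/eqP nE i2_gt1 i2n] := adm.
have i1n : (i1 < n)%N by lia.
have i12n : ((i1 + i2).-1 < n)%N by lia.
exists (Ordinal i1n, Ordinal i12n).
  by rewrite /proper_range /=; lia.
by rewrite /range_sum /range_bound /= prednK//; lia.
Qed.

End FacetGeometry.
(** * Orientations *)

(** The dimension [size E] occurs in the type of the matrix; replacing it by an equal number here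
    avoids casting matrices later. *)
Lemma oriented_size (R : realType) (V : lmodType R) (s : int) (E b : seq V) k :
  size E = k -> oriented s E b <->
  size b = k /\ exists2 P : 'M[R]_k,
    (forall i : 'I_k, b`_i = \sum_j P i j *: E`_j) & 0 < s%:~R * \det P.
Proof. by move=> <-. Qed.

Section BasisDeterminant.
Variable R : realType.

Definition dlt m k : 'rV[R]_m := \row_(j < m) (j == k :> nat)%:R.

Lemma entry_dlt m k l : (l < m)%N -> entry l (dlt m k) = (l == k)%:R.
Proof. by move=> lm; rewrite /dlt (entry_row (fun j => (j == k)%:R)). Qed.

Lemma rsum_dlt m k : (k < m)%N -> rsum 0 m (dlt m k) = 1.
Proof.
move=> km; rewrite rsumT (bigD1 (Ordinal km))//= mxE eqxx big1 ?addr0//.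
by move=> j; rewrite mxE -val_eqE /= => /negbTE ->.
Qed.

Lemma loday_basisE n : loday_basis R n =
  [seq dlt n.-1 0 - dlt n.-1 j.+1 | j <- iota 0 n.-2].
Proof.
by apply: eq_map => j; apply/rowP => k; rewrite !mxE.
Qed.

Lemma size_loday_basis n : size (loday_basis R n) = n.-2.
Proof. by rewrite size_map size_iota. Qed.

Lemma nth_loday_basis n j : (j < n.-2)%N ->
  (loday_basis R n)`_j = dlt n.-1 0 - dlt n.-1 j.+1.
Proof.
by move=> jn; rewrite loday_basisE (nth_map 0%N) ?size_iota// nth_iota.
Qed.

Lemma rsum_loday_basis n j : (j < n.-2)%N -> rsum 0 n.-1 (loday_basis R n)`_j = 0.
Proof. by move=> jn; rewrite nth_loday_basis// linearB /= !rsum_dlt ?subrr//; lia. Qed.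

Lemma mem_loday_basis n v : v \in loday_basis R n -> rsum 0 n.-1 v = 0.
Proof.
by move=> /(nthP 0)[j]; rewrite size_loday_basis => jn <-; exact: rsum_loday_basis.
Qed.

Lemma entry_loday_basis n j k : (j < n.-2)%N -> (k < n.-2)%N ->
  entry k.+1 (loday_basis R n)`_j = - (k == j)%:R.
Proof.
move=> jn kn; rewrite nth_loday_basis// linearB /= !entry_dlt ?sub0r//; lia.
Qed.

Lemma rsum_recl m k (x : 'rV[R]_m) :
  rsum 0 k.+1 x = entry 0 x + \sum_(j < k) entry j.+1 x.
Proof.
elim: k => [|k IHk]; first by rewrite big_ord0 addr0.
by rewrite (rsum_cat (b := k.+1))// IHk big_ord_recr /= addrA.
Qed.

(** Coordinate j + 1 is nonzero only in basis vector j, where it is -1; this dictates the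
    coefficients. Coordinate 0 then agrees because both sides have sum 0. *)
Lemma loday_basis_expand n (u : 'rV[R]_n.-1) : rsum 0 n.-1 u = 0 ->
  u = \sum_(j < n.-2) - entry j.+1 u *: (loday_basis R n)`_j.
Proof.
move=> uT; set v := \sum_(j < _) _.
have vT : rsum 0 n.-1 v = 0.
  by rewrite linear_sum big1//= => j _; rewrite linearZ /= rsum_loday_basis ?mulr0.
have vS k : (k < n.-2)%N -> entry k.+1 v = entry k.+1 u.
  move=> kn; rewrite linear_sum (bigD1 (Ordinal kn))//= big1 ?addr0.
    by rewrite linearZ /= entry_loday_basis// eqxx mulrN mulr1 opprK.
  move=> j; rewrite -val_eqE /= linearZ /= entry_loday_basis// eq_sym => /negbTE ->.
  by rewrite oppr0 mulr0.
apply: entry_inj => -[|k] kn; last by rewrite vS//; lia.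
have n2 : n.-1 = n.-2.+1 by lia.
have SE : \sum_(j < n.-2) entry j.+1 v = \sum_(j < n.-2) entry j.+1 u.
  by apply: eq_bigr => j _; exact: vS.
apply: (addIr (\sum_(j < n.-2) entry j.+1 u)).
by rewrite -[LHS]rsum_recl -SE -rsum_recl -n2 uT vT.
Qed.

(* A vector u of coordinate sum 0 has coordinates - u_(j+1) in [loday_basis]. *)
Definition basis_det n (b : seq 'rV[R]_n.-1) : R :=
  \det (\matrix_(i < n.-2, j < n.-2) - entry j.+1 b`_i).

(** The coefficients in [oriented] can be read off the coordinates other than the first, so the
    matrix there must be the one of [basis_det]. *)
Lemma oriented_loday_basis n s (b : seq 'rV[R]_n.-1) :
  oriented s (loday_basis R n) b <->
  [/\ size b = n.-2, forall u, u \in b -> rsum 0 n.-1 u = 0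
    & 0 < s%:~R * basis_det b].
Proof.
rewrite (oriented_size _ _ (size_loday_basis n)); split.
  case=> sb [P bE Ppos]; split=> //.
    move=> u /(nthP 0)[i]; rewrite sb => ib <-.
    rewrite (bE (Ordinal ib)) linear_sum big1//= => j _.
    by rewrite linearZ /= rsum_loday_basis ?mulr0.
  suff -> : basis_det b = \det P by [].
  congr (\det _); apply/matrixP => i j; rewrite mxE.
  apply: (canLR opprK); rewrite bE [LHS]linear_sum (bigD1 j)//=.
  rewrite linearZ /= entry_loday_basis// eqxx mulrN mulr1 big1 ?addr0//.
  move=> k; rewrite linearZ /= entry_loday_basis// -val_eqE eq_sym /= => /negbTE ->.
  by rewrite oppr0 mulr0.
case=> sb bT bpos; split=> //.
exists (\matrix_(i, j) - entry j.+1 b`_i) => // i.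
rewrite {1}[b`_i]loday_basis_expand; last by apply: bT; rewrite mem_nth ?sb.
by apply: eq_bigr => j _; rewrite mxE.
Qed.

Lemma basis_det_swap n (s1 s2 : seq 'rV[R]_n.-1) x y :
  size (s1 ++ x :: y :: s2) = n.-2 ->
  basis_det (s1 ++ x :: y :: s2) = - basis_det (s1 ++ y :: x :: s2).
Proof.
rewrite size_cat /= => sz.
have l1 : (size s1 < n.-2)%N by lia.
have l2 : ((size s1).+1 < n.-2)%N by lia.
pose i := Ordinal l1; pose j := Ordinal l2.
have ij : i != j by rewrite -val_eqE /=; lia.
rewrite /basis_det; set A := \matrix_(_, _) _; set B := \matrix_(_, _) _.
suff -> : A = row_perm (tperm i j) B.
  by rewrite row_permE det_mulmx det_perm odd_tperm ij expr1 mulN1r.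
apply/matrixP => k l; rewrite !mxE; congr (- rsum _ _ _).
rewrite !nth_cat; case: tpermP => [->|->|/eqP ki /eqP kj] /=.
- by rewrite ltnn subnn ltnNge leqnSn /= subSnn.
- by rewrite ltnn subnn ltnNge leqnSn /= subSnn.
case: ltnP => // sk; move: ki kj; rewrite -!val_eqE /= => ki kj.
by case E : (k - size s1)%N => [|[|m]] //=; lia.
Qed.

Lemma basis_det_move n (s1 t s2 : seq 'rV[R]_n.-1) x :
  size (s1 ++ x :: t ++ s2) = n.-2 ->
  basis_det (s1 ++ x :: t ++ s2) =
  (-1) ^+ size t * basis_det (s1 ++ t ++ x :: s2).
Proof.
elim: t s1 => [|y t IHt] s1 /=; first by rewrite mul1r.
move=> sz; rewrite basis_det_swap// -cat_rcons IHt; last first.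
  by move: sz; rewrite !size_cat size_rcons /= size_cat; lia.
by rewrite cat_rcons exprS mulN1r mulNr.
Qed.

(** Each vector of [t] crosses every vector of [u], at the cost of one transposition each. *)
Lemma basis_det_catCA n (s1 t u s2 : seq 'rV[R]_n.-1) :
  size (s1 ++ t ++ u ++ s2) = n.-2 ->
  basis_det (s1 ++ t ++ u ++ s2) =
  (-1) ^+ (size t * size u) * basis_det (s1 ++ u ++ t ++ s2).
Proof.
elim: t s1 => [|x t IHt] s1 /=; first by rewrite mul1r.
move=> sz; rewrite -cat_rcons IHt; last first.
  by move: sz; rewrite !size_cat size_rcons /= !size_cat; lia.
rewrite cat_rcons basis_det_move; last by move: sz; rewrite /= !size_cat /= !size_cat; lia.
by rewrite mulrA -exprD mulSn addnC.
Qed.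

(** Column j records coordinate j + 1, so row k has its entry for [k.+1] on the diagonal, where the
    two minus signs cancel, and its entry for [c k] to the left of it, or nowhere if [c k] is 0. *)
Lemma basis_det_triangular n (e : nat -> R) (c : nat -> nat) :
  (forall k, (c k <= k)%N) ->
  basis_det [seq e k *: (dlt n.-1 (c k) - dlt n.-1 k.+1) | k <- iota 0 n.-2] =
  \prod_(k < n.-2) e k.
Proof.
move=> ck; rewrite /basis_det.
have E (i j : 'I_n.-2) : entry j.+1 [seq e k *: (dlt n.-1 (c k) - dlt n.-1 k.+1)
    | k <- iota 0 n.-2]`_i = e i * ((j.+1 == c i)%:R - (j == i)%:R).
  have := ltn_ord i; have := ltn_ord j => jn iN.
  rewrite (nth_map 0%N) ?size_iota// nth_iota// add0n linearZ linearB /=.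
  by rewrite !entry_dlt//; lia.
rewrite det_trig.
  apply: eq_bigr => i _; rewrite mxE E eqxx gtn_eqF ?ltnS//.
  by rewrite sub0r mulrN mulr1 opprK.
apply/is_trig_mxP => i j ij; rewrite mxE E.
have := ck i => ci.
have /negbTE -> : j.+1 != c i by lia.
have /negbTE -> : j != i by rewrite -val_eqE /=; lia.
by rewrite subr0 mulr0 oppr0.
Qed.

End BasisDeterminant.
Arguments dlt {R} m k.
(** The family [v :: b] arises from [v0 :: T] by a block triangular matrix with diagonal blocks c
    and [Q]. In particular, changing the leading vector by a combination of [T] does not matter,
    which makes the sign independent of the outward vector. *)
Lemma basis_det_cons (R : realType) n k (T b : seq 'rV[R]_n.-1) v0 v c
    (r : 'I_k -> R) (Q : 'M[R]_k) : n.-2 = k.+1 ->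
  v = c *: v0 + \sum_j r j *: T`_j -> (forall i : 'I_k, b`_i = \sum_j Q i j *: T`_j) ->
  basis_det (v :: b) = c * \det Q * basis_det (v0 :: T).
Proof.
move=> nk vE bE; rewrite /basis_det nk.
set M := \matrix_(i < k.+1, j < k.+1) - entry j.+1 (v0 :: T)`_i.
pose B : 'M[R]_(1 + k) := block_mx c%:M (\row_j r j) 0 Q.
have -> : c * \det Q = \det B by rewrite det_ublock det_scalar1.
rewrite -det_mulmx; congr (\det _); apply/matrixP => i j.
rewrite mxE [RHS]mxE (@big_split_ord _ _ _ 1 k) big_ord1 /=.
have M0 : M (@lshift 1 k ord0) j = - entry j.+1 v0 by rewrite mxE.
have MS l : M (@rshift 1 k l) j = - entry j.+1 T`_l by rewrite mxE.
rewrite M0; case: (@split_ordP 1 k i) => i0 -> /=.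
  rewrite ord1 block_mxEul !mxE mulr1n vE linearD linearZ linear_sum /=.
  rewrite opprD mulrN -sumrN; congr (_ + _); apply: eq_bigr => l _.
  by rewrite MS block_mxEur mxE linearZ /= mulrN.
rewrite block_mxEdl mxE mul0r add0r.
transitivity (- entry j.+1 b`_i0) => //.
rewrite bE [X in - X]linear_sum -sumrN; apply: eq_bigr => l _.
by rewrite MS block_mxEdr linearZ /= mulrN.
Qed.

Lemma linear_comb (R : realType) (U V : lmodType R) (f : U -> V) k
    (c : 'I_k -> R) (v : 'I_k -> U) : linear f ->
  f (\sum_j c j *: v j) = \sum_j c j *: f (v j).
Proof.
move=> fL; pose L : {linear U -> V} := HB.pack f (GRing.isLinear.Build R U V _ f fL).
rewrite (_ : f = L)// linear_sum; apply: eq_bigr => j _; exact: linearZ.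
Qed.

(** * Product orientation and boundary orientation of a facet *)

Section FacetOrientation.
Variables (R : realType) (n i1 i2 i3 : nat).
Hypothesis adm : admissible n i1 i2 i3.
Let i2_gt1 : (1 < i2)%N. Proof. by case/and3P: adm. Qed.
Let nE : (i1 + i2 + i3)%N = n. Proof. by case/and3P: adm => /eqP. Qed.
Let i2_lt : (i2 < n)%N. Proof. by case/and3P: adm; lia. Qed.

Local Notation theta := (@theta R n i1 i2 i3).
Local Notation facet_basis := (theta_basis n i1 i2 i3
  (loday_basis R (i1.+1 + i3)) (loday_basis R i2)).
Local Notation K := (loday R (weight1 n)).
Local Notation F := (loday_facet R (weight1 n) i1 i2).
Local Notation d := (@dlt R n.-1).

Definition x_position k := if (k < i1)%N then k else (k + i2.-1)%N.

Lemma theta_dlt_x k : (k < i1 + i3)%N -> theta (dlt _ k) 0 = d (x_position k).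
Proof.
move=> ki; apply: entry_inj => l ln; rewrite entry_theta// [RHS]entry_dlt// /x_position.
case: (ltnP k i1) => ki1; case: ltnP => li1;
  try by rewrite entry_dlt; [congr (_%:R); lia|lia].
  case: ltnP => lp; first by rewrite linear0 (_ : (l == _) = false)//; lia.
  by rewrite entry_dlt; [congr (_%:R); lia|lia].
case: ltnP => lp; first by rewrite linear0 (_ : (l == _) = false)//; lia.
by rewrite entry_dlt; [congr (_%:R); lia|lia].
Qed.

Lemma theta_dlt_y k : (k < i2.-1)%N -> theta 0 (dlt _ k) = d (i1 + k).
Proof.
move=> ki; apply: entry_inj => l ln; rewrite entry_theta// [RHS]entry_dlt//.
case: ltnP => li1; first by rewrite linear0 (_ : (l == _) = false)//; lia.
case: ltnP => lp; first by rewrite entry_dlt; [congr (_%:R); lia|lia].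
by rewrite linear0 (_ : (l == _) = false)//; lia.
Qed.

Lemma facet_basisE : facet_basis =
  [seq d (x_position 0) - d (x_position j.+1) | j <- iota 0 (i1 + i3).-1] ++
  [seq d i1 - d (i1 + j.+1)%N | j <- iota 0 i2.-2].
Proof.
rewrite /theta_basis !loday_basisE -!map_comp; congr (_ ++ _).
  apply/eq_in_map => j; rewrite mem_iota => /= jlt.
  rewrite addrC -scaleN1r (theta_linear_x i2_gt1 nE) !theta_dlt_x; [|by lia..].
  by rewrite scaleN1r addrC.
apply/eq_in_map => j; rewrite mem_iota => /= jlt.
rewrite addrC -scaleN1r (theta_linear_y i2_gt1 nE) !theta_dlt_y; [|by lia..].
by rewrite scaleN1r addrC addn0.
Qed.

Lemma size_facet_basis : size facet_basis = (i1 + i3).-1 + i2.-2.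
Proof. by rewrite size_cat !size_map !size_iota. Qed.

(** The two equations say that both components of u under [theta] have coordinate sum 0, so each
    expands in its own Loday basis. *)
Lemma facet_basis_span u :
  rsum 0 n.-1 u = 0 -> rsum i1 (i1 + i2).-1 u = 0 -> u \in <<facet_basis>>%VS.
Proof.
have [x [y ->]] := thetaP i2_gt1 nE u.
rewrite rsum_theta_block// rsum_thetaT// => xyT yT.
move: xyT; rewrite yT addr0 => xT.
rewrite (theta_split i2_gt1 nE); apply: rpredD.
  rewrite [x](@loday_basis_expand R (i1.+1 + i3) x xT).
  rewrite (linear_comb _ _ (theta_linear_x i2_gt1 nE)).
  apply: rpred_sum => j _; apply/rpredZ/memv_span.
  rewrite mem_cat; apply/orP; left; apply/mapP.
  exists (loday_basis R (i1.+1 + i3))`_j => //.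
  apply: mem_nth; apply: leq_trans (ltn_ord j) (eq_leq _).
  exact/esym/(@size_loday_basis R (i1.+1 + i3)).
rewrite [y]loday_basis_expand// (linear_comb _ _ (theta_linear_y i2_gt1 nE)).
apply: rpred_sum => j _; apply/rpredZ/memv_span.
rewrite mem_cat; apply/orP; right; apply/mapP.
by exists (loday_basis R i2)`_j => //; apply: mem_nth; rewrite size_loday_basis.
Qed.

Lemma facet_basis_direction u : u \in facet_basis ->
  rsum 0 n.-1 u = 0 /\ rsum i1 (i1 + i2).-1 u = 0.
Proof.
rewrite mem_cat => /orP[] /mapP[v vE ->]; rewrite rsum_theta_block// rsum_thetaT//.
  by rewrite !linear0 addr0 (@mem_loday_basis R (i1.+1 + i3) v vE).
by rewrite linear0 add0r mem_loday_basis.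
Qed.

(** Like the vectors of the facet basis, this outward vector is a difference of two unit vectors, as
    the triangular form of the determinant requires. *)
Definition outward_vector : 'rV[R]_n.-1 := d (x_position 0) - d i1.

Lemma outward_vectorE : outward_vector = theta (dlt _ 0) (- dlt _ 0).
Proof.
rewrite (theta_split i2_gt1 nE) -scaleN1r -[(-1) *: _]addr0.
rewrite (theta_linear_y i2_gt1 nE) (theta0 R i2_gt1 nE) addr0 theta_dlt_x; last by lia.
by rewrite theta_dlt_y ?addn0 ?scaleN1r//; lia.
Qed.

Lemma outward_vectorT : rsum 0 n.-1 outward_vector = 0.
Proof.
have x0 : (x_position 0 < n.-1)%N by rewrite /x_position; case: ifP; lia.
have i1n : (i1 < n.-1)%N by lia.
by rewrite linearB /= !rsum_dlt// subrr.
Qed.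

Lemma outward_vector_block : rsum i1 (i1 + i2).-1 outward_vector = - 1.
Proof.
by rewrite outward_vectorE rsum_theta_block// linearN /= rsum_dlt//; lia.
Qed.

(* Permuting the rows, so that the vectors involving the basis vectors
   [d 1], [d 2], ... occur in this order, makes the matrix triangular; only
   moving whole runs of rows past each other contributes a sign. *)
Lemma basis_det_facet :
  basis_det (outward_vector :: facet_basis) = - (-1) ^+ (i1 + i2 * i3).
Proof.
rewrite facet_basisE.
(* For i1 = 0 the first coordinate of x lands after the block, so the outward vector is
   [d i2.-1 - d 0], the negative of a row of the triangular form: there [e] is -1. It moves together
   with [T1], a run of i3 vectors in all, past the i2 - 2 vectors of [T2]. *)
have [i10|i1p] := posnP i1.
  pose T1 := [seq d (x_position 0) - d (x_position j.+1) | j <- iota 0 (i1 + i3).-1].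
  pose T2 := [seq d i1 - d (i1 + j.+1)%N | j <- iota 0 i2.-2].
  have -> : outward_vector :: T1 ++ T2 = [::] ++ (outward_vector :: T1) ++ T2 ++ [::].
    by rewrite cats0.
  rewrite basis_det_catCA; last by rewrite /= cats0 size_cat !size_map !size_iota; lia.
  pose e k : R := if (k == i2.-2) then - 1 else 1.
  pose c k := if (k < i2.-1)%N then 0%N else i2.-1.
  have -> : [::] ++ T2 ++ (outward_vector :: T1) ++ [::] =
      [seq e k *: (d (c k) - d k.+1) | k <- iota 0 n.-2].
    have -> : n.-2 = (i2.-2 + (1 + i3.-1))%N by lia.
    rewrite !iotaD !map_cat /= cats0; congr (_ ++ _ :: _).
    - apply/eq_in_map => j; rewrite mem_iota => jlt.
      by rewrite /e /c i10 ifF ?ifT ?scale1r//; lia.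
    - rewrite /e /c /= eqxx ifT; last by lia.
      rewrite scaleN1r opprB /outward_vector /x_position i10 /= add0n.
      by congr (d _ - d _); lia.
    - rewrite (_ : (0 + i2.-2 + 1)%N = (i2.-1 + 0)%N); last by lia.
      rewrite iotaDl -map_comp /T1 i10; apply/eq_in_map => j; rewrite mem_iota => jlt /=.
      rewrite /e /c ifF ?ifF ?scale1r ?/x_position ?i10 /= ?add0n; [|by lia..].
      by congr (d _ - d _); lia.
  rewrite basis_det_triangular; last by move=> k; rewrite /c; case: ltnP.
  have kn : (i2.-2 < n.-2)%N by lia.
  rewrite (bigD1 (Ordinal kn))//= {1}/e eqxx big1 ?mulr1; last first.
    by move=> k; rewrite -val_eqE /= /e => /negbTE ->.
  rewrite /= !size_map !size_iota mulrN1; congr (- _).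
  rewrite -signr_odd -[RHS]signr_odd; congr (_ ^+ nat_of_bool _).
  have [c2 c2E] : exists c2, i2 = c2.+2 by exists i2.-2; lia.
  have [c3 c3E] : exists c3, i3 = c3.+1 by exists i3.-1; lia.
  by rewrite c2E c3E i10 !add0n -!pred_Sn !(oddM, oddS); case: (odd c2); case: (odd c3).
(* For i1 > 0 the outward vector is [d 0 - d i1]. Passing it behind the i1 - 1 vectors [A] before
   the block, and then exchanging the i3 vectors [B] after the block with the i2 - 2 vectors [C]
   inside it, gives the sign. *)
have x0 : x_position 0 = 0%N by rewrite /x_position i1p.
have -> : (i1 + i3).-1 = (i1.-1 + i3)%N by lia.
rewrite iotaD map_cat -catA.
set A := [seq _ | j <- iota 0 i1.-1]; set B := [seq _ | j <- iota _ i3].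
set C := [seq _ | j <- iota 0 i2.-2].
rewrite -[_ :: _]/([::] ++ outward_vector :: A ++ (B ++ C)) basis_det_move; last first.
  by rewrite /= !size_cat !size_map !size_iota; lia.
have -> : [::] ++ A ++ outward_vector :: B ++ C =
    (A ++ [:: outward_vector]) ++ B ++ C ++ [::] by rewrite cats0 -catA.
rewrite basis_det_catCA; last by rewrite !size_cat !size_map !size_iota /=; lia.
pose c k := if (i1 <= k < i1 + i2.-2)%N then i1 else 0%N.
have -> : (A ++ [:: outward_vector]) ++ C ++ B ++ [::] =
    [seq 1 *: (d (c k) - d k.+1) | k <- iota 0 n.-2].
  have -> : n.-2 = (i1.-1 + (1 + (i2.-2 + i3)))%N by lia.
  rewrite !iotaD !map_cat /= cats0 -catA /=; congr (_ ++ _ :: _ ++ _).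
  - apply/eq_in_map => j; rewrite mem_iota => jlt.
    rewrite /c ifF ?scale1r ?x0; last by lia.
    by congr (d _ - d _); rewrite /x_position; case: ifP; lia.
  - rewrite /c ifF ?scale1r /outward_vector ?x0; last by lia.
    by congr (d _ - d _); lia.
  - rewrite (_ : (0 + i1.-1 + 1)%N = (i1 + 0)%N); last by lia.
    rewrite iotaDl -map_comp; apply/eq_in_map => j; rewrite mem_iota => jlt /=.
    by rewrite /c ifT ?scale1r ?addnS//; lia.
  - rewrite (_ : (0 + i1.-1 + 1 + i2.-2)%N = (i2.-1 + i1.-1)%N); last by lia.
    rewrite iotaDl -map_comp; apply/eq_in_map => j; rewrite mem_iota => jlt /=.
    rewrite /c ifF ?scale1r ?x0; last by lia.
    by congr (d _ - d _); rewrite /x_position; case: ifP; lia.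
rewrite basis_det_triangular; last by move=> k; rewrite /c; case: ifP; lia.
rewrite big1// mulr1 !size_map !size_iota -exprD -[RHS]mulN1r -exprS.
rewrite -signr_odd -[RHS]signr_odd; congr (_ ^+ nat_of_bool _).
have [c2 c2E] : exists c2, i2 = c2.+2 by exists i2.-2; lia.
have [c1 c1E] : exists c1, i1 = c1.+1 by exists i1.-1; lia.
rewrite c2E c1E -!pred_Sn !(oddD, oddM, oddS).
by case: (odd c1); case: (odd c2); case: (odd i3).
Qed.

(** The sign [eps] is the determinant of the facet basis preceded by [outward_vector]. Any outward
    vector is a positive multiple c of that vector plus a vector tangent to the facet, so preceding
    b by it gives the determinant c [eps] det Q, where Q expresses b in the facet basis; as [eps]
    has square 1, only the sign of det Q counts. *)
Lemma oriented_facet_basis b (eps := (- (-1) ^+ (i1 + i2 * i3) : int)) :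
  oriented 1 facet_basis b <-> boundary_oriented eps K F (loday_basis R n) b.
Proof.
set k := ((i1 + i3).-1 + i2.-2)%N.
have nk : n.-2 = k.+1 by rewrite /k; lia.
have epsE : eps%:~R = basis_det (outward_vector :: facet_basis) :> R.
  by rewrite basis_det_facet /eps rmorphN rmorphXn /= rmorphN1.
have eps2 : eps%:~R * basis_det (outward_vector :: facet_basis) = 1 :> R.
  by rewrite -epsE -rmorphM /eps mulrNN -exprD addnn -signr_odd odd_double.
have out : outward K F outward_vector.
  by apply/(outwardP adm); rewrite outward_vectorT outward_vector_block ltrN10.
have spanP u : direction F u -> exists r : 'I_k -> R, u = \sum_j r j *: facet_basis`_j.
  rewrite (direction_facet R adm) => -[uT uB].
  have := coord_span (X := in_tuple facet_basis) (facet_basis_span uT uB).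
  move: (coord _) => cc uE.
  have sE := esym size_facet_basis.
  exists (fun j => cc (cast_ord sE j) u).
  rewrite {1}uE (reindex (cast_ord sE))//=.
  by exists (cast_ord (esym sE)) => j _; rewrite ?cast_ordK ?cast_ordKV.
rewrite (oriented_size _ _ size_facet_basis) -/k; split.
  case=> sb [Q bE]; rewrite mul1r => Qpos.
  have bF u : u \in b -> direction F u.
    move=> /(nthP 0)[i]; rewrite sb => ik <-; rewrite (bE (Ordinal ik)).
    rewrite (direction_facet R adm); split; rewrite linear_sum big1//= => j _;
      have /facet_basis_direction[uT uB] : facet_basis`_j \in facet_basis
        by rewrite mem_nth ?size_facet_basis.
    - by rewrite linearZ /= uT mulr0.
    - by rewrite linearZ /= uB mulr0.
  split=> //; first by exists outward_vector.
  move=> v /[dup] vout /(outwardP adm)[vT vB]; apply/oriented_loday_basis.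
  (* Since [outward_vector] has block sum -1, subtracting this multiple of it from v leaves block
     sum 0, that is, a vector tangent to the facet. *)
  pose c := - rsum i1 (i1 + i2).-1 v.
  have c0 : 0 < c by rewrite oppr_gt0.
  have [r rE] : exists r : 'I_k -> R,
      v - c *: outward_vector = \sum_j r j *: facet_basis`_j.
    apply: spanP; rewrite (direction_facet R adm); split.
      by rewrite linearB linearZ /= vT outward_vectorT mulr0 subr0.
    by rewrite linearB linearZ /= outward_vector_block mulrN1 opprK /c subrr.
  split.
  - by rewrite /= sb nk.
  - move=> u; rewrite inE => /predU1P[->//|/bF].
    by rewrite (direction_facet R adm) => -[].
  rewrite (basis_det_cons (c := c) (r := r) (v0 := outward_vector) nk _ bE); last first.
    by rewrite -rE addrC subrK.
  by rewrite mulrCA eps2 mulr1 mulr_gt0.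
(* For the converse, testing the single vector [outward_vector] suffices; it corresponds to c = 1
   and r = 0 below. *)
case=> bF [_ _] /(_ _ out) /oriented_loday_basis[/= sb _ bpos].
have {}sb : size b = k by move: sb; rewrite nk => -[].
split=> //.
have {}bF (i : 'I_k) : exists r : 'I_k -> R, b`_i = \sum_j r j *: facet_basis`_j.
  by apply: spanP; apply: bF; rewrite mem_nth ?sb.
have [r rE] := choice bF.
exists (\matrix_(i, j) r i j) => [i|].
  by rewrite rE; apply: eq_bigr => j _; rewrite mxE.
rewrite mul1r; move: bpos.
rewrite (basis_det_cons (c := 1) (r := fun=> 0) (Q := \matrix_(i, j) r i j)
  (v0 := outward_vector) (T := facet_basis) nk).
- by rewrite mul1r mulrCA eps2 mulr1.
- by rewrite scale1r big1 ?addr0// => j _; rewrite scale0r.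
- by move=> i; rewrite rE; apply: eq_bigr => j _; rewrite mxE.
Qed.

End FacetOrientation.
(** * The equation (B) *)

(** The position of the only argument that is not a leaf gives [i1], its label gives [i2], and the
    label of the root then gives [i3]. *)
Lemma op_comp_inj i1 i2 i3 j1 j2 j3 :
  op_comp i1 i2 i3 = op_comp j1 j2 j3 -> [/\ i1 = j1, i2 = j2 & i3 = j3].
Proof.
rewrite /op_comp => -[ij argsE].
pose is_node (t : GenTree.tree unit) := if t is GenTree.Node _ _ then true else false.
have findE k1 k2 k3 : find is_node
    (nseq k1 op_id ++ op_m k2 (nseq k2 op_id) :: nseq k3 op_id) = k1.
  by rewrite find_cat has_nseq andbF size_nseq /= addn0.
have ij1 : i1 = j1 by rewrite -[LHS](findE i1 i2 i3) argsE findE.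
have := congr1 (fun s => nth op_id s i1) argsE.
rewrite !nth_cat !size_nseq ij1 ltnn subnn /= => -[ij2 _].
by split=> //; lia.
Qed.

(** Distinct triples give distinct trees, so a single term of the triple sum contributes to the
    coefficient. *)
Lemma coeff_ainf_rhsB n i1 i2 i3 : admissible n i1 i2 i3 ->
  coeff (op_comp i1 i2 i3) (ainf_rhsB n) = - (-1) ^+ (i1 + i2 * i3).
Proof.
move=> adm; have /and3P[/eqP nE _ _] := adm.
have i1n : (i1 < n.+1)%N by lia.
have i2n : (i2 < n.+1)%N by lia.
have i3n : (i3 < n.+1)%N by lia.
have coeff_op (j1 j2 j3 : 'I_n.+1) :
    coeff (op_comp i1 i2 i3) << ((-1) ^+ (j1 + j2 * j3)) *g op_comp j1 j2 j3 >> =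
    (-1) ^+ (j1 + j2 * j3) *
      [&& j1 == Ordinal i1n, j2 == Ordinal i2n & j3 == Ordinal i3n]%:R :> int.
  rewrite coeffU; congr (_ * (nat_of_bool _)%:R); apply/eqP/and3P.
    by move/op_comp_inj => [e1 e2 e3]; split; rewrite -val_eqE /= ?e1 ?e2 ?e3.
  by case=> /eqP -> /eqP -> /eqP ->.
rewrite /ainf_rhsB coeffN; congr (- _).
rewrite raddf_sum (bigD1 (Ordinal i1n))//= [X in _ + X]big1 ?addr0; last first.
  move=> j1 /negbTE j1i; rewrite raddf_sum big1// => j2 _.
  by rewrite raddf_sum big1// => j3 _; rewrite /= coeff_op j1i mulr0.
rewrite raddf_sum (bigD1 (Ordinal i2n))//= [X in _ + X]big1 ?addr0; last first.
  move=> j2 /negbTE j2i; rewrite raddf_sum big1// => j3 _.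
  by rewrite /= (coeff_op (Ordinal i1n)) j2i andbF mulr0.
rewrite raddf_sum (bigD1 (Ordinal i3n))//= [X in _ + X]big1 ?addr0; last first.
  move=> j3 /andP[_ /negbTE j3i].
  by rewrite (coeff_op (Ordinal i1n) (Ordinal i2n)) j3i !andbF mulr0.
by rewrite (coeff_op (Ordinal i1n) (Ordinal i2n) (Ordinal i3n)) !eqxx mulr1.
Qed.

Theorem proposition4 (R : realType) (n : nat) (hn : (3 <= n)%N) :
  let w := weight1 n in
  let K := loday R w in
  relative_boundary K =
    [set x | exists i1 i2 i3, admissible n i1 i2 i3 /\
       theta_prod n i1 i2 i3 (loday R (wbar w i1 i2 i3))
                             (loday R (wtilde w i1 i2)) x] /\
  forall i1 i2 i3, admissible n i1 i2 i3 ->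
    let eps : int := - (-1) ^+ (i1 + i2 * i3) in
    let F := loday_facet R w i1 i2 in
    [/\ F = theta_prod n i1 i2 i3 (loday R (wbar w i1 i2 i3))
                                  (loday R (wtilde w i1 i2)),
        forall b : seq 'rV[R]_n.-1,
          oriented 1 (theta_basis n i1 i2 i3
                        (loday_basis R (i1.+1 + i3)) (loday_basis R i2)) b <->
          boundary_oriented eps K F (loday_basis R n) b
      & coeff (op_comp i1 i2 i3) (ainf_rhsB n) = eps].
Proof.
move=> w K; split.
  rewrite relative_boundary_loday; last by lia.
  apply/seteqP; split=> x /= -[i1 [i2 [i3 [adm Fx]]]]; exists i1, i2, i3; split=> //.
    by rewrite -(loday_facetE R adm).
  by rewrite (loday_facetE R adm).
move=> i1 i2 i3 adm eps F; split.
- exact: loday_facetE.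
- by move=> b; exact: oriented_facet_basis.
- exact: coeff_ainf_rhsB.
Qed.
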